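(* For every $w\in\mathcal{A}^0[[t]]$, \[ L(\sigma(w))=L(\sigma(\tau(w))). \]
   Context: $\mathbb{D}=\{z\in\mathbb{C}:|z|\le1\}$, $\mathbb{B}=\{z\in\mathbb{D}\setminus\{0\}:\mathrm{Re}(z)\le\frac12\}\cup\{1\}$. $\mathcal{A}=\mathbb{Q}\langle x,e_z\ (z\in\mathbb{B})\rangle$ is the non-commutative polynomial algebra in letters $x$, $e_z$, and $\mathcal{A}^0=\mathbb{Q}\oplus\bigoplus_{z\in\mathbb{B},\ \mathrm{Re}(z)\ne\frac12,\ |z|\ne1}\mathbb{Q}e_z\oplus\bigoplus_{z\in\mathbb{B},\ \mathrm{Re}(z)\ne\frac12}e_z\mathcal{A}x\oplus\bigoplus_{z,z'\in\mathbb{B},\ \mathrm{Re}(z)\ne\frac12,\ |z'|\ne1}e_z\mathcal{A}e_{z'}$. $\mathcal{A}[[t]]$ and $\mathcal{A}^0[[t]]$ denote formal power series in a central variable $t$. The automorphism $\sigma$ of $\mathcal{A}[[t]]$ fixes $t$ and $x$ and sends $e_z\mapsto e_z(1-xt)^{-1}$; the anti-automorphism $\tau$ of $\mathcal{A}[[t]]$ fixes $t$ and $\mathbb{Q}$ and is given by $\tau(x)=e_1$, $\tau(e_1)=x$, $\tau(e_z)=-e_{\frac{z}{z-1}}(1-e_{\frac{z}{z-1}}t)^{-1}$ for $z\in\mathbb{B}\setminus\{1\}$. A word $e_{z_1}x^{k_1-1}\cdots e_{z_r}x^{k_r-1}$ is associated with $\boldsymbol{z}=(z_1,\dots,z_r)$,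 $\boldsymbol{k}=(k_1,\dots,k_r)$, and $1$ with the empty pair. The $\mathbb{Q}$-linear map $L:\mathcal{A}^0[[t]]\to\mathbb{C}[[t]]$ acts coefficientwise in $t$ and sends a word $w\in\mathcal{A}^0$ associated with $(\boldsymbol{z},\boldsymbol{k})$ to $\mathrm{Li}^{\mathrm{sh}}_{\boldsymbol{k}}(\boldsymbol{z})=\sum_{0=m_0<m_1<\cdots<m_r}\prod_i z_i^{m_i-m_{i-1}}m_i^{-k_i}$ (equal to $1$ for the empty pair). *)

(* Defs.v *)
From HB Require Import structures.
From mathcomp Require Import all_boot all_order all_algebra.
From mathcomp Require Import finmap boolp classical_sets functions reals.
From mathcomp Require Import topology normedtype sequences.
From mathcomp Require Import complex ring lra.
(* The notations of monalg clash with those of MathComp-Analysis. *)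
From mathcomp Require Import -(notations) monalg.

Set Implicit Arguments.
Unset Strict Implicit.
Unset Printing Implicit Defensive.

Import Order.TTheory GRing.Theory Num.Theory.
Import numFieldNormedType.Exports.

Local Open Scope ring_scope.
Local Open Scope complex_scope.

(* [fps A] is A[[t]] with t central: the product is the Cauchy product. *)
Record fps (A : Type) := Fps { coeft :> nat -> A }.

Lemma fpsP (A : Type) (f g : fps A) : coeft f =1 coeft g <-> f = g.
Proof.
split=> [|-> //]; case: f g => [f] [g] /= fg.
by congr Fps; apply: funext.
Qed.

HB.instance Definition _ (A : Type) := [isNew for @coeft A].
HB.instance Definition _ (A : Type) := gen_eqMixin (fps A).
HB.instance Definition _ (A : Type) := gen_choiceMixin (fps A).

Section FpsZmod.
Variable A : zmodType.
Implicit Types f g h : fps A.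

Definition fps_zero : fps A := Fps (fun=> 0).
Definition fps_opp f : fps A := Fps (fun n => - f n).
Definition fps_add f g : fps A := Fps (fun n => f n + g n).

Fact fps_addA : associative fps_add.
Proof. by move=> f g h; apply/fpsP => n /=; rewrite addrA. Qed.
Fact fps_addC : commutative fps_add.
Proof. by move=> f g; apply/fpsP => n /=; rewrite addrC. Qed.
Fact fps_add0 : left_id fps_zero fps_add.
Proof. by move=> f; apply/fpsP => n /=; rewrite add0r. Qed.
Fact fps_addN : left_inverse fps_zero fps_opp fps_add.
Proof. by move=> f; apply/fpsP => n /=; rewrite addNr. Qed.

HB.instance Definition _ :=
  GRing.isZmodule.Build (fps A) fps_addA fps_addC fps_add0 fps_addN.

Lemma coeft0 n : (0 : fps A) n = 0. Proof. by []. Qed.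
Lemma coeftD f g n : (f + g) n = f n + g n. Proof. by []. Qed.
Lemma coeftN f n : (- f) n = - f n. Proof. by []. Qed.
Lemma coeftB f g n : (f - g) n = f n - g n. Proof. by []. Qed.

Lemma coeft_sum (I : Type) (r : seq I) (P : pred I) (F : I -> fps A) n :
  (\sum_(i <- r | P i) F i) n = \sum_(i <- r | P i) F i n.
Proof. by elim/big_rec2: _ => // i x y _ <-. Qed.

End FpsZmod.

Section FpsRing.
Variable A : nzRingType.
Implicit Types f g h : fps A.

Definition fpsC (a : A) : fps A := Fps (fun n => if n == 0%N then a else 0).
Definition fps_mul f g : fps A :=
  Fps (fun n => \sum_(i < n.+1) f i * g (n - i)%N).

Let trunc N f : {poly A} := \poly_(i < N) f i.

Let coef_mul f g n N : (n < N)%N ->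
  fps_mul f g n = (trunc N f * trunc N g)`_n.
Proof.
move=> nN; rewrite coefM; apply: eq_bigr => i _; rewrite !coef_poly.
have iN : (i < N)%N by apply: leq_trans nN; rewrite ltn_ord.
by rewrite iN (leq_ltn_trans (leq_subr _ _) nN).
Qed.

Let coefM_congr (p p' q q' : {poly A}) n :
  (forall i, (i <= n)%N -> p`_i = p'`_i) ->
  (forall i, (i <= n)%N -> q`_i = q'`_i) -> (p * q)`_n = (p' * q')`_n.
Proof.
move=> pp' qq'; rewrite !coefM; apply: eq_bigr => i _.
by rewrite pp' ?qq' ?leq_subr // -ltnS.
Qed.

Fact fps_mulA : associative fps_mul.
Proof.
move=> f g h; apply/fpsP => n.
rewrite !(@coef_mul _ _ n n.+1) //.
transitivity ((trunc n.+1 f * (trunc n.+1 g * trunc n.+1 h))`_n).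
  apply: coefM_congr => // i; rewrite -ltnS => iN.
  by rewrite [LHS]coef_poly iN (coef_mul _ _ iN).
rewrite mulrA; apply: coefM_congr => // i; rewrite -ltnS => iN.
by rewrite [RHS]coef_poly iN (coef_mul _ _ iN).
Qed.

Lemma fps_mulCE a f n : fps_mul (fpsC a) f n = a * f n.
Proof.
rewrite /= big_ord_recl /= subn0 big1 ?addr0 // => i _.
by rewrite /bump /= mul0r.
Qed.

Lemma fps_mulrCE a f n : fps_mul f (fpsC a) n = f n * a.
Proof.
rewrite /= big_ord_recr /= subnn eqxx big1 ?add0r // => i _.
by rewrite subn_eq0 leqNgt ltn_ord /= mulr0.
Qed.

Fact fps_mul1 : left_id (fpsC 1) fps_mul.
Proof. by move=> f; apply/fpsP => n; rewrite fps_mulCE mul1r. Qed.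
Fact fps_mulr1 : right_id (fpsC 1) fps_mul.
Proof. by move=> f; apply/fpsP => n; rewrite fps_mulrCE mulr1. Qed.
Fact fps_mulDl : left_distributive fps_mul +%R.
Proof.
move=> f g h; apply/fpsP => n; rewrite coeftD /= -big_split /=.
by apply: eq_bigr => i _; rewrite mulrDl.
Qed.
Fact fps_mulDr : right_distributive fps_mul +%R.
Proof.
move=> f g h; apply/fpsP => n; rewrite coeftD /= -big_split /=.
by apply: eq_bigr => i _; rewrite mulrDr.
Qed.
Fact fps_1_neq0 : fpsC 1 != 0.
Proof.
by apply/eqP => /fpsP /(_ 0%N) /eqP; rewrite coeft0 /= oner_eq0.
Qed.

HB.instance Definition _ := GRing.Zmodule_isNzRing.Build (fps A)
  fps_mulA fps_mul1 fps_mulr1 fps_mulDl fps_mulDr fps_1_neq0.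

Lemma coeftM f g n : (f * g) n = \sum_(i < n.+1) f i * g (n - i)%N.
Proof. by []. Qed.

Lemma coeftCM a f n : (fpsC a * f) n = a * f n.
Proof. exact: fps_mulCE. Qed.
Lemma coeftMC f a n : (f * fpsC a) n = f n * a.
Proof. exact: fps_mulrCE. Qed.

Lemma fpsC_is_zmod_morphism : zmod_morphism fpsC.
Proof. by move=> a b; apply/fpsP => -[|n]; rewrite coeftB /= ?subr0. Qed.
Lemma fpsC_is_monoid_morphism : monoid_morphism fpsC.
Proof.
split=> // a b; apply/fpsP => n; rewrite coeftCM /=.
by case: eqP; rewrite ?mulr0.
Qed.

HB.instance Definition _ :=
  GRing.isZmodMorphism.Build A (fps A) fpsC fpsC_is_zmod_morphism.
HB.instance Definition _ :=
  GRing.isMonoidMorphism.Build A (fps A) fpsC fpsC_is_monoid_morphism.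

Definition fpsT : fps A := Fps (fun n => (n == 1%N)%:R).

Lemma coeftMT f n : (f * fpsT) n = if n is m.+1 then f m else 0.
Proof.
rewrite coeftM; case: n => [|n]; first by rewrite big_ord1 /= mulr0.
rewrite 2!big_ord_recr /= subnn mulr0 addr0 subSnn mulr1 big1 ?add0r // => i _.
by rewrite /= subSn ?(ltnW (ltn_ord i)) // eqSS subn_eq0 leqNgt ltn_ord mulr0.
Qed.

Lemma coeftTM f n : (fpsT * f) n = if n is m.+1 then f m else 0.
Proof.
rewrite coeftM; case: n => [|n]; first by rewrite big_ord1 /= mul0r.
rewrite 2!big_ord_recl /= mul0r add0r mul1r subSS subn0 big1 ?addr0 // => i _.
by rewrite /= mul0r.
Qed.

Lemma fpsT_comm f : GRing.comm f fpsT.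
Proof. by apply/fpsP => n; rewrite coeftMT coeftTM. Qed.

Lemma coeftMTn f k n : (f * fpsT ^+ k) n = if (k <= n)%N then f (n - k)%N else 0.
Proof.
elim: k n => [|k IHk] n; first by rewrite expr0 mulr1 subn0.
by rewrite exprSr mulrA coeftMT; case: n => [|n] //; rewrite IHk subSS.
Qed.

(* (1 - a t)^-1; see [fps_geomVl] and [fps_geomVr]. *)
Definition fps_geom (a : A) : fps A := Fps (fun n => a ^+ n).

Lemma fps_geomVl a : fps_geom a * (1 - fpsC a * fpsT) = 1.
Proof.
apply/fpsP => n; rewrite mulrBr mulr1 mulrA coeftB coeftMT.
case: n => [|n]; first by rewrite subr0.
by rewrite coeftMC /= exprSr subrr.
Qed.

Lemma fps_geomVr a : (1 - fpsC a * fpsT) * fps_geom a = 1.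
Proof.
apply/fpsP => n; rewrite mulrBl mul1r -mulrA coeftB coeftCM coeftTM.
case: n => [|n]; first by rewrite mulr0 subr0.
by rewrite /= exprS subrr.
Qed.

End FpsRing.

Arguments fpsT {A}.

(* The extension sum_i a_i t^i |-> sum_i phi(a_i) t^i of a map
   phi : A -> B[[t]] to A[[t]]. *)
Definition fps_extend (A : Type) (B : nzRingType) (phi : A -> fps B)
    (f : fps A) : fps B :=
  Fps (fun n => \sum_(i < n.+1) phi (f i) (n - i)%N).

Section FpsExtendTheory.
Variables (A B : nzRingType) (phi : A -> fps B).
Hypothesis phiB : zmod_morphism phi.
Hypothesis phi1 : phi 1 = 1.
Implicit Types f g : fps A.

#[local]
HB.instance Definition _ := GRing.isZmodMorphism.Build A (fps B) phi phiB.

Let phi_sum n (F : 'I_n -> A) : phi (\sum_i F i) = \sum_i phi (F i).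
Proof. exact: raddf_sum. Qed.

Lemma fps_extendB : zmod_morphism (fps_extend phi).
Proof.
move=> f g; apply/fpsP => n; rewrite coeftB /= -sumrB.
by apply: eq_bigr => i _; rewrite phiB.
Qed.

Lemma fps_extendC a : fps_extend phi (fpsC a) = phi a.
Proof.
apply/fpsP => n /=; rewrite big_ord_recl /= subn0 big1 ?addr0 // => i _.
by rewrite raddf0.
Qed.

Lemma fps_extendT : fps_extend phi fpsT = fpsT.
Proof.
apply/fpsP => -[|n] /=; first by rewrite big_ord1 /= raddf0.
rewrite 2!big_ord_recl /= raddf0 add0r phi1 subSS subn0 big1 ?addr0 //.
by case: n.
Qed.

Let coeft_hornerT (p : {poly fps B}) n :
  p.[fpsT] n = \sum_(i < n.+1) p`_i (n - i)%N.
Proof.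
rewrite (@horner_coef_wide _ (maxn (size p) n.+1)) ?leq_maxl //.
rewrite coeft_sum (big_ord_widen (maxn (size p) n.+1)
  (fun i => p`_i (n - i)%N)) ?leq_maxr // [RHS]big_mkcond.
by apply: eq_bigr => i _; rewrite coeftMTn ltnS.
Qed.

Let extend_horner f n N : (n < N)%N ->
  fps_extend phi f n = (\poly_(i < N) phi (f i)).[fpsT] n.
Proof.
move=> nN; rewrite coeft_hornerT; apply: eq_bigr => i _.
by rewrite coef_poly (leq_trans (ltn_ord i)).
Qed.

Let extend_mul f g n : (fps_extend phi f * fps_extend phi g) n =
  (\poly_(i < n.+1) phi (f i) * \poly_(i < n.+1) phi (g i)).[fpsT] n.
Proof.
rewrite hornerM_comm; last exact/commr_sym/fpsT_comm.
rewrite !coeftM; apply: eq_bigr => i _.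
by rewrite !(@extend_horner _ _ n.+1) // ltnS leq_subr.
Qed.

Lemma fps_extendM : {morph phi : a b / a * b} ->
  {morph fps_extend phi : f g / f * g}.
Proof.
move=> phiM f g; apply/fpsP => n; rewrite extend_mul coeft_hornerT.
apply: eq_bigr => i _; rewrite coeftM coefM phi_sum !coeft_sum; apply: eq_bigr => j _.
rewrite !coef_poly phiM (leq_trans (ltn_ord j) (ltn_ord i)).
by rewrite (leq_ltn_trans (leq_subr _ _) (ltn_ord i)).
Qed.

Lemma fps_extend_antiM : {morph phi : a b / a * b >-> b * a} ->
  {morph fps_extend phi : f g / f * g >-> g * f}.
Proof.
move=> phiM f g; apply/fpsP => n; rewrite extend_mul coeft_hornerT.
apply: eq_bigr => i _; rewrite coeftM coefMr phi_sum !coeft_sum; apply: eq_bigr => j _.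
rewrite !coef_poly phiM (leq_trans (ltn_ord j) (ltn_ord i)).
by rewrite (leq_ltn_trans (leq_subr _ _) (ltn_ord i)).
Qed.

End FpsExtendTheory.

Section Alphabet.
Variable R : realType.
Implicit Types z : R[i].

Definition inB z : bool :=
  [&& z != 0, `|z| <= 1 & complex.Re z <= 2^-1] || (z == 1).

Record BB := BBval { bval :> R[i]; bvalP : inB bval }.

HB.instance Definition _ := [isSub for bval].
HB.instance Definition _ := [Choice of BB by <:].

Fact inB1 : inB 1. Proof. by rewrite /inB eqxx orbT. Qed.
Definition BB1 : BB := BBval inB1.

(* The default value [BB1] is irrelevant for z <> 1, by [bdualE]. *)
Definition bdual (z : BB) : BB := insubd BB1 (val z / (val z - 1)).

Let norm_dual z : z - 1 != 0 ->
  ((`|z / (z - 1)| <= 1) = (complex.Re z <= 2^-1)) *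
  ((`|z / (z - 1)| == 1) = (complex.Re z == 2^-1)).
Proof.
move=> z1; have n1 : `|z - 1| != 0 by rewrite normr_eq0.
rewrite normrM normfV ler_pdivrMr ?normr_gt0 // mul1r.
rewrite -[X in _ == X](divff n1) (inj_eq (mulIf (invr_neq0 n1))).
rewrite -(@ler_pXn2r _ 2) ?nnegrE ?normr_ge0 //.
rewrite -(@eqrXn2 _ 2 `|z|) ?normr_ge0 // -!add_Re2_Im2 lecR.
rewrite (inj_eq (@complexI _)); case: z {z1 n1} => a b /=; rewrite subr0.
by split; [apply/idP/idP => ?; lra | apply/eqP/eqP => ?; lra].
Qed.

Let dualK z : z - 1 != 0 ->
  (z / (z - 1) - 1 != 0) * (z / (z - 1) / (z / (z - 1) - 1) = z).
Proof.
move=> z1; have -> : z / (z - 1) - 1 = (z - 1)^-1 by field.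
by rewrite invr_eq0 invrK divfK.
Qed.

Lemma inB_dual z : inB z -> z != 1 -> inB (z / (z - 1)).
Proof.
rewrite -subr_eq0 /inB => + z1; rewrite -[z == 1]subr_eq0 (negPf z1) orbF.
move=> /and3P[z0 zn zr]; have [w1 ww] := dualK z1.
rewrite -[complex.Re _ <= _](norm_dual w1) ww zn norm_dual // zr.
by rewrite mulf_neq0 // invr_eq0.
Qed.

Lemma bdualE (z : BB) : z != BB1 -> bval (bdual z) = bval z / (bval z - 1).
Proof. by move=> z1; apply: insubdK; apply: inB_dual => //; exact: bvalP. Qed.

Lemma bdual_boundary (z : BB) : z != BB1 ->
  ((`|bval (bdual z)| == 1) = (complex.Re (bval z) == 2^-1)) *
  ((complex.Re (bval (bdual z)) == 2^-1) = (`|bval z| == 1)).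
Proof.
move=> z1; rewrite bdualE //; move: z1; rewrite -val_eqE -subr_eq0 /= => z1.
by have [w1 ww] := dualK z1; rewrite norm_dual // -(norm_dual w1) ww.
Qed.

(* [X] is the letter x and [E z] is the letter e_z. *)
Inductive letter := X | E of BB.

Definition letter_to_option l := if l is E z then Some z else None.
Definition letter_of_option o := if o is Some z then E z else X.
Fact letter_to_optionK : cancel letter_to_option letter_of_option.
Proof. by case. Qed.
HB.instance Definition _ := Choice.copy letter (can_type letter_to_optionK).

End Alphabet.

Arguments X {R}.
Arguments BB1 {R}.

Notation word R := (fmonom (letter R)).
Notation alg R := (malg (word R) rat).

Definition gen (R : realType) (l : letter R) : alg R := mkmalgU (fmu l) 1.

Section Polylog.
Variable R : realType.

Local Notation A := (alg R).
Local Notation x := (gen X : A).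
Local Notation e z := (gen (E z) : A).

Definition scalC (c : rat) : fps A := fpsC (mkmalgU mone c).

Definition sigma_letter (l : letter R) : fps A :=
  match l with
  | X => fpsC x
  | E z => fpsC (e z) * fps_geom x
  end.

Definition sigma : fps A -> fps A :=
  fps_extend (mmap scalC (fun w : word R => \prod_(l <- w) sigma_letter l)).

Definition tau_letter (l : letter R) : fps A :=
  match l with
  | X => fpsC (e BB1)
  | E z => if z == BB1 then fpsC x
           else - (fpsC (e (bdual z)) * fps_geom (e (bdual z)))
  end.

Definition tau : fps A -> fps A :=
  fps_extend (mmap scalC (fun w : word R => \prod_(l <- rev w) tau_letter l)).

Definition head_ok (w : seq (letter R)) : bool :=
  if w is E z :: _ then complex.Re (bval z) != 2^-1 else false.

Definition last_ok (w : seq (letter R)) : bool :=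
  if w is l :: s then
    match last l s with X => true | E z => `|bval z| != 1 end
  else false.

(* The words spanning A^0: the empty word, and the words whose first letter is
   some e_z with Re z <> 1/2 and whose last letter is x or some e_z' with
   |z'| <> 1; the single letters e_z are the case where both coincide. *)
Definition admissible (w : seq (letter R)) : bool :=
  (w == [::]) || head_ok w && last_ok w.

Definition inA0 (a : A) : Prop :=
  forall w : word R, w \in msupp a -> admissible w.

Definition inA0t (f : fps A) : Prop := forall n, inA0 (f n).

Fixpoint word_index_rec (w : seq (letter R)) : nat * seq (BB R * nat) :=
  match w with
  | [::] => (0%N, [::])
  | X :: s => ((word_index_rec s).1.+1, (word_index_rec s).2)
  | E z :: s => (0%N, (z, (word_index_rec s).1.+1) :: (word_index_rec s).2)
  end.

(* The sequence of the pairs (z_i, k_i) associated with a word, cf.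
   [word_indexE]; an initial power of x, which does not occur in the words of
   A^0, is ignored. *)
Definition word_index (w : seq (letter R)) := (word_index_rec w).2.

(* The sum is over 0 = m_0 < m_1 < ... < m_r <= N, with r = size k. *)
Definition Lish_trunc (z : seq R[i]) (k : seq nat) (N : nat) : R[i] :=
  \sum_(m : (size k).-tuple 'I_N.+1 | sorted ltn (0%N :: map val m))
    let m_ := nth 0%N (0%N :: map val m) in
    \prod_(j < size k)
      (z`_j ^+ (m_ j.+1 - m_ j) / (m_ j.+1)%:R ^+ nth 0%N k j).

Definition Lish (z : seq R[i]) (k : seq nat) : R[i] :=
  limn (Lish_trunc z k : nat -> R[i]^o).

Definition L_word (w : seq (letter R)) : R[i] :=
  Lish [seq bval p.1 | p <- word_index w] [seq p.2 | p <- word_index w].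

(* Only meaningful on A^0[[t]], where the series converge; sigma and tau
   preserve it by [sigma_inA0t] and [tau_inA0t]. *)
Definition L (f : fps A) : fps R[i] :=
  Fps (fun n => mmap ratr (fun w : word R => L_word w) (f n)).

Lemma word_indexE (s : seq (BB R * nat)) : all (fun p => 0 < p.2)%N s ->
  word_index (flatten [seq E p.1 :: nseq p.2.-1 X | p <- s]) = s.
Proof.
have Xs n w : word_index_rec (nseq n X ++ w) =
    ((n + (word_index_rec w).1)%N, (word_index_rec w).2).
  by elim: n => [|n /= ->] //=; rewrite -surjective_pairing.
suff H : all (fun p => 0 < p.2)%N s -> word_index_rec
    (flatten [seq E p.1 :: nseq p.2.-1 X | p <- s]) = (0%N, s).
  by move=> /H; rewrite /word_index => ->.
elim: s => [|[z k] s IHs] //= /andP[k0 /IHs IH].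
by rewrite Xs IH /= addn0 prednK.
Qed.

Lemma Lish_nil : Lish [::] [::] = 1.
Proof.
suff H : Lish_trunc [::] [::] = fun=> 1.
  by rewrite /Lish H; apply: (@cvg_lim R[i]^o) => //; exact: cvg_cst.
apply/funext => N; rewrite /Lish_trunc (big_pred1 [tuple]) ?big_ord0 // => m.
by rewrite tuple0 /= eqxx.
Qed.

Lemma malgC_comm c (a : A) : mkmalgU mone c * a = a * mkmalgU mone c.
Proof.
rewrite [LHS]fgmulUg [RHS]fgmulgU; apply: eq_bigr => w _.
by rewrite mul1m mulm1 mulrC.
Qed.

Lemma scalC_comm c (f : fps A) : GRing.comm (scalC c) f.
Proof.
by apply/fpsP => n; rewrite [LHS]coeftCM [RHS]coeftMC; exact: malgC_comm.
Qed.

Lemma scalC_is_zmod_morphism : zmod_morphism scalC.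
Proof. by move=> a b; rewrite /scalC (monalgUB mone) (raddfB (@fpsC A)). Qed.
Lemma scalC_is_monoid_morphism : monoid_morphism scalC.
Proof.
split; first exact: (rmorph1 (@fpsC A)).
by move=> a b; rewrite /scalC mpolyCM; exact: (rmorphM (@fpsC A)).
Qed.

HB.instance Definition _ := GRing.isZmodMorphism.Build rat (fps A) scalC
  scalC_is_zmod_morphism.
HB.instance Definition _ := GRing.isMonoidMorphism.Build rat (fps A) scalC
  scalC_is_monoid_morphism.

End Polylog.

Section Morphisms.
Variable R : realType.

Local Notation A := (alg R).

Section WordExtension.
Variable h : word R -> fps A.
Hypothesis h1 : h mone = 1.

Let mulrACA_comm (S : nzRingType) (a b u v : S) : GRing.comm b u ->
  a * b * (u * v) = a * u * (b * v).
Proof. by move=> bu; rewrite -!mulrA [b * _]mulrA bu !mulrA. Qed.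

Let extendU c w : mmap (@scalC R) h (mkmalgU w c) = scalC R c * h w.
Proof. exact: mmapU. Qed.

Let scalC1 : scalC R 1 = 1. Proof. exact: (rmorph1 (@scalC R)). Qed.

Let extend_sum I (r : seq I) (F : I -> A) :
  mmap (@scalC R) h (\sum_(i <- r) F i) = \sum_(i <- r) mmap (@scalC R) h (F i).
Proof. exact: raddf_sum. Qed.

Let scalCM a b : scalC R (a * b) = scalC R a * scalC R b.
Proof. exact: (rmorphM (@scalC R)). Qed.

Lemma word_extend_gen w : mmap (@scalC R) h (mkmalgU w 1) = h w.
Proof. by rewrite extendU scalC1 mul1r. Qed.

Lemma word_extend1 : mmap (@scalC R) h 1 = 1.
Proof. by rewrite -h1; exact: word_extend_gen. Qed.

Lemma word_extendM : {morph h : v w / mmul v w >-> v * w} ->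
  {morph mmap (@scalC R) h : a b / a * b}.
Proof.
move=> hM a b; rewrite malgME extend_sum mulr_suml.
apply: eq_bigr => v _; rewrite extend_sum mulr_sumr; apply: eq_bigr => w _.
by rewrite !extendU scalCM hM; exact/mulrACA_comm/scalC_comm.
Qed.

Lemma word_extend_antiM : {morph h : v w / mmul v w >-> w * v} ->
  {morph mmap (@scalC R) h : a b / a * b >-> b * a}.
Proof.
move=> hM a b; rewrite malgME extend_sum mulr_sumr.
apply: eq_bigr => v _; rewrite extend_sum mulr_suml; apply: eq_bigr => w _.
by rewrite !extendU mulrC scalCM hM; exact/mulrACA_comm/scalC_comm.
Qed.

End WordExtension.

Let sigma_word (w : word R) := \prod_(l <- w) sigma_letter l.
Let tau_word (w : word R) := \prod_(l <- rev w) tau_letter l.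

Let sigma_word1 : sigma_word mone = 1.
Proof. by rewrite /sigma_word fm1 big_nil. Qed.
Let tau_word1 : tau_word mone = 1.
Proof. by rewrite /tau_word fm1 big_nil. Qed.
Let sigma_wordM : {morph sigma_word : v w / mmul v w >-> v * w}.
Proof. by move=> v w; rewrite /sigma_word fmM big_cat. Qed.
Let tau_wordM : {morph tau_word : v w / mmul v w >-> w * v}.
Proof. by move=> v w; rewrite /tau_word fmM rev_cat big_cat. Qed.

Lemma sigma_is_zmod_morphism : zmod_morphism (@sigma R).
Proof. exact/fps_extendB/raddfB. Qed.

Lemma sigma_is_monoid_morphism : monoid_morphism (@sigma R).
Proof.
split; last exact/fps_extendM/word_extendM/sigma_wordM/raddfB.
by rewrite /sigma -(rmorph1 (@fpsC A)) fps_extendC ?word_extend1 //; exact: raddfB.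
Qed.

Lemma sigma_t : sigma fpsT = fpsT :> fps A.
Proof. by apply: fps_extendT; [exact: raddfB | exact: word_extend1]. Qed.

Lemma sigma_gen l : sigma (fpsC (gen l)) = sigma_letter l :> fps A.
Proof.
rewrite /sigma fps_extendC; last exact: raddfB.
by rewrite word_extend_gen /= fmU big_seq1.
Qed.

Lemma tau_is_zmod_morphism : zmod_morphism (@tau R).
Proof. exact/fps_extendB/raddfB. Qed.

Lemma tau1 : tau 1 = 1 :> fps A.
Proof.
by rewrite /tau -(rmorph1 (@fpsC A)) fps_extendC ?word_extend1 //; exact: raddfB.
Qed.

Lemma tau_antiM : {morph @tau R : f g / f * g >-> g * f}.
Proof. exact/fps_extend_antiM/word_extend_antiM/tau_wordM/raddfB. Qed.

Lemma tau_t : tau fpsT = fpsT :> fps A.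
Proof. by apply: fps_extendT; [exact: raddfB | exact: word_extend1]. Qed.

Lemma tau_gen l : tau (fpsC (gen l)) = tau_letter l :> fps A.
Proof.
rewrite /tau fps_extendC; last exact: raddfB.
by rewrite word_extend_gen /= fmU big_seq1.
Qed.

(* Stability of A^0[[t]], so that L is applied inside its domain. *)
Section Support.
Implicit Types P Q : pred (seq (letter R)).

Definition supp_in P (f : fps A) : Prop :=
  forall n (w : word R), w \in msupp (f n) -> P w.

Let supp0 P : supp_in P 0.
Proof. by move=> n w; rewrite msupp0. Qed.

Let suppD P f g : supp_in P f -> supp_in P g -> supp_in P (f + g).
Proof.
move=> Pf Pg n w /(fsubsetP (msuppD_le _ _)); rewrite inE.
by case/orP; [exact: Pf | exact: Pg].
Qed.

Let suppN P f : supp_in P f -> supp_in P (- f).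
Proof. by move=> Pf n w; rewrite coeftN msuppN; exact: Pf. Qed.

Let msupp_sum (I : Type) (r : seq I) (F : I -> A) (w : word R) :
  w \in msupp (\sum_(i <- r) F i) -> exists i, w \in msupp (F i).
Proof.
elim: r => [|i r IHr]; first by rewrite big_nil msupp0.
rewrite big_cons => /(fsubsetP (msuppD_le _ _)); rewrite inE.
by case/orP => [|/IHr //]; exists i.
Qed.

Let suppM P Q (PQ : pred (seq (letter R))) f g :
    (forall v w, P v -> Q w -> PQ (v ++ w)) ->
  supp_in P f -> supp_in Q g -> supp_in PQ (f * g).
Proof.
move=> H Pf Qg n w; rewrite coeftM => /msupp_sum[i /msuppM_le[u [v [uf vg ->]]]].
by rewrite fmM; apply: H; [exact: Pf uf | exact: Qg vg].
Qed.

Let suppC P a : (forall w : word R, w \in msupp a -> P w) ->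
  supp_in P (fpsC a).
Proof. by move=> Pa [|n] w /=; [exact: Pa | rewrite msupp0]. Qed.

Let suppT f : supp_in predT f. Proof. by []. Qed.

Let supp_gen l : supp_in (pred1 [:: l]) (fpsC (gen l)).
Proof. by apply: suppC => w; rewrite msuppU1 inE => /eqP->; rewrite /= fmU. Qed.

Let supp_geom l :
  supp_in [pred w | (w == [::]) || (last l w == l)] (fps_geom (gen l)).
Proof.
move=> n; rewrite /=; elim: n => [|n IHn] w.
  by rewrite expr0 -mpolyC1E msuppU1 inE => /eqP->; rewrite /= fm1.
rewrite exprSr => /msuppM_le[u [v [_]]]; rewrite msuppU1 inE => /eqP-> ->.
by rewrite /= fmM fmU last_cat eqxx orbT.
Qed.

Let supp_extend (h : word R -> fps A) f : inA0t f ->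
  (forall w : word R, admissible w -> supp_in (@admissible R) (h w)) ->
  inA0t (fps_extend (mmap (@scalC R) h) f).
Proof.
move=> f0 hP n w /= /msupp_sum[j].
have : supp_in (@admissible R) (mmap (@scalC R) h (f j)); last by apply.
rewrite /mmap big_seq; elim/big_ind: _ => [|g g'|v vf]; [exact: supp0 | exact: suppD |].
have hv := hP v (f0 _ _ vf).
apply: (@suppM (pred1 [::]) (@admissible R)) hv => [_ ? /eqP-> //|].
by apply: suppC => u /(fsubsetP msuppU_le); rewrite inE => /eqP->; rewrite /= fm1.
Qed.

Let admissible_hl (w : seq (letter R)) :
  w != [::] -> admissible w = head_ok w && last_ok w.
Proof. by rewrite /admissible => /negPf->. Qed.

Let supp_hl f : supp_in (@head_ok R) f -> supp_in (@last_ok R) f ->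
  supp_in (@admissible R) f.
Proof.
by move=> Hf Lf n w wf; rewrite /admissible (Hf n w wf) (Lf n w wf) orbT.
Qed.

Let head_mul f g : supp_in (@head_ok R) f -> supp_in (@head_ok R) (f * g).
Proof.
move=> Hf; apply: (@suppM (@head_ok R) predT) Hf (@suppT g).
by case=> [|[|z] s].
Qed.

Let last_mul f g : supp_in (@last_ok R) g -> supp_in (@last_ok R) (f * g).
Proof.
move=> Lg; apply: (@suppM predT (@last_ok R)) (@suppT f) Lg => u v _.
by case: u v => [|l s] // [|m v]; rewrite //= last_cat.
Qed.

Let supp1 : supp_in (@admissible R) 1.
Proof. by apply: suppC => w; rewrite -mpolyC1E msuppU1 inE => /eqP->; rewrite fm1. Qed.

Let head_gen l : head_ok [:: l] -> supp_in (@head_ok R) (fpsC (gen l)).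
Proof. by move=> hl n w /supp_gen /= /eqP->. Qed.

Let last_gen l : last_ok [:: l] -> supp_in (@last_ok R) (fpsC (gen l)).
Proof. by move=> hl n w /supp_gen /= /eqP->. Qed.

Let last_gen_geom l m : last_ok [:: l] -> last_ok [:: m] ->
  supp_in (@last_ok R) (fpsC (gen l) * fps_geom (gen m)).
Proof.
move=> hl hm; apply: suppM (@supp_gen l) (@supp_geom m) => _ w /eqP->.
case/orP => [/eqP-> //|]; case: w => [|k w] //= /eqP wm.
by rewrite wm; case: (m) hm.
Qed.

Lemma sigma_inA0t (f : fps A) : inA0t f -> inA0t (sigma f).
Proof.
move=> f0; apply: supp_extend f0 _ => -[w]; have [->|w0] /= := eqVneq w [::].
  by rewrite big_nil.
rewrite admissible_hl // => /andP[]; case: w w0 => // l s _ Hl Ll.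
apply: supp_hl.
  rewrite big_cons; apply: head_mul.
  case: l Hl {Ll} => [|z Hz]; first discriminate.
  exact/head_mul/head_gen.
have {}Ll : last_ok [:: last l s] := Ll.
rewrite lastI big_rcons; apply: last_mul.
case: (last l s) Ll => [_|z Lz]; first exact: last_gen.
by apply: last_gen_geom; [exact: Lz | exact: isT].
Qed.

Lemma tau_inA0t (f : fps A) : inA0t f -> inA0t (tau f).
Proof.
move=> f0; apply: supp_extend f0 _ => -[w]; have [->|w0] /= := eqVneq w [::].
  by rewrite big_nil.
rewrite admissible_hl // => /andP[]; case: w w0 => // l s _ Hl Ll.
apply: supp_hl; last first.
  rewrite rev_cons big_rcons; apply: last_mul.
  case: l Hl {Ll} => [|z Hz]; first discriminate.
  rewrite /tau_letter; case: (eqVneq z BB1) => z1; first exact: last_gen.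
  have Lz : last_ok [:: E (bdual z)] by rewrite /last_ok /= bdual_boundary.
  exact/suppN/last_gen_geom.
have {}Ll : last_ok [:: last l s] := Ll.
rewrite lastI rev_rcons big_cons; apply: head_mul.
case: (last l s) Ll => [_|z Lz]; rewrite /tau_letter.
  by apply: head_gen; rewrite /head_ok /=; apply/eqP; lra.
have z1 : z != BB1.
  by apply: contraTneq Lz => ->; rewrite /last_ok /= normr1 eqxx.
rewrite (negPf z1); apply/suppN/head_mul/head_gen.
by rewrite /head_ok bdual_boundary.
Qed.
End Support.

End Morphisms.

(* Main.v *)
Require Import Defs.
From HB Require Import structures.
From mathcomp Require Import all_boot all_order all_algebra.
From mathcomp Require Import finmap boolp classical_sets functions reals.
From mathcomp Require Import topology normedtype sequences.
From mathcomp Require Import complex ring lra.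
From mathcomp Require Import -(notations) monalg.

Set Implicit Arguments.
Unset Strict Implicit.
Unset Printing Implicit Defensive.

Import Order.TTheory GRing.Theory Num.Theory.
Import numFieldNormedType.Exports.

Local Open Scope ring_scope.
Local Open Scope complex_scope.

(* Connected sums. For a word u, let phi_u(m) be the sum of the weights of
   L (sigma u) over the chains ending at m, and set
     Z_N(u; v) = sum_(m, n <= N) phi_u(m) phi_v(n) C(m, n),
   where C(m, n) = Gamma(m+1-t) Gamma(n+1-t) / (Gamma(m+n+1-t) Gamma(1-t)).
   Since C(m, 0) = C(0, n) = 1, Z_N(w; 1) and Z_N(1; tau w) are the truncations
   at N of L (sigma w) and L (sigma (tau w)). The contiguity relations of C and an
   Abel summation show that moving the last letter of u to the end of v, through
   tau, changes Z_N by O((log N)^p / N) in each coefficient of t. Hence both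
   truncations have the same limit; the convergence of the left one is absolute. *)

(** The factor (1 - x t)^-1 in sigma replaces the weight 1/m of e_z by 1/(m-t), so appending e_z
    gives a first-order recurrence with coefficients m+1-t and m-t. The factor (1 - e_w t)^-1 in tau
    cancels one of these t, leaving n and n+1-t, which are the coefficients that the contiguity
    relations of C need; w = z/(z-1) is what makes the two recurrences match. Only finite sums are
    manipulated: the pieces u and v of an admissible word need not be admissible, so the
    intermediate double sums are never asked to converge, and the price is explicit boundary terms.
    These are estimated modulo t^K for every K, where the formal series C is bounded by an inverse
    binomial coefficient times a power of a logarithm. *)

Fact fps_mulC (A : comNzRingType) : commutative (@fps_mul A).
Proof.
move=> f g; apply/fpsP => n /=; rewrite (reindex_inj rev_ord_inj) /=.
by apply: eq_bigr => i _; rewrite mulrC subSS subKn // -ltnS.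
Qed.

HB.instance Definition _ (A : comNzRingType) :=
  GRing.PzRing_hasCommutativeMul.Build (fps A) (@fps_mulC A).

(** * The connector and its contiguity relations *)

Section Connector.
Variable F : numFieldType.
Implicit Types (f g h : nat -> fps F) (m n N : nat).

Local Notation t := (@fpsT F).
Local Notation "a %:S" := (@fpsC F a).

Definition nsubt n : fps F := n%:R - t.

(** This is Gamma(n+1-t) / (n! Gamma(1-t)), and [pochV] is its inverse. Splitting off n! leaves
    constant coefficient 1, and the factorials combine in [connector] to an inverse binomial
    coefficient. *)
Definition poch n : fps F := \prod_(j < n) (1 - (j.+1%:R^-1)%:S * t).
Definition pochV n : fps F := \prod_(j < n) fps_geom (j.+1%:R^-1).

(* Gamma(m+1-t) Gamma(n+1-t) / (Gamma(m+n+1-t) Gamma(1-t)). *)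
Definition connector m n : fps F :=
  ('C(m + n, n)%:R^-1)%:S * (poch m * poch n * pochV (m + n)).

Lemma poch_pochV n : poch n * pochV n = 1.
Proof. by rewrite -big_split big1 // => j _; exact: fps_geomVr. Qed.

Lemma pochS n : n.+1%:R * poch n.+1 = nsubt n.+1 * poch n.
Proof.
rewrite /poch big_ord_recr /= -/(poch n) mulrCA mulrC; congr (_ * _).
rewrite mulrBr mulr1 mulrA -[X in X * _%:S](rmorph_nat (@fpsC F)) -rmorphM.
by rewrite divff ?pnatr_eq0 // rmorph1 mul1r.
Qed.

Lemma pochVS n : nsubt n.+1 * pochV n.+1 = n.+1%:R * pochV n.
Proof.
rewrite -[LHS]mulr1 -[X in _ * X](poch_pochV n) mulrACA -pochS -mulrA.
by rewrite [poch _ * _]mulrA poch_pochV mul1r.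
Qed.

Lemma connectorC m n : connector m n = connector n m.
Proof.
rewrite /connector addnC [poch n * _]mulrC.
by rewrite -(bin_sub (leq_addr m n)) addKn.
Qed.

Lemma connectorm0 m : connector m 0 = 1.
Proof.
by rewrite /connector addn0 bin0 invr1 rmorph1 mul1r [poch 0]big_ord0 mulr1 poch_pochV.
Qed.

Lemma fps_natr_inj n (x y : fps F) : n.+1%:R * x = n.+1%:R * y -> x = y.
Proof.
move=> /(congr1 (fun x => (n.+1%:R^-1)%:S * x)); rewrite !mulrA.
rewrite -[X in _%:S * X](rmorph_nat (@fpsC F)) -rmorphM mulVf ?pnatr_eq0 //.
by rewrite rmorph1 !mul1r.
Qed.

(** The ratio (n+1-t)/(m+n+1-t) comes from the absorption identity for binomials and the one-step
    rules for [poch] and [pochV]. The other contiguity relations follow from it by symmetry and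
    linear algebra. *)
Lemma connectorSr m n :
  nsubt (m + n).+1 * connector m n.+1 = nsubt n.+1 * connector m n.
Proof.
have /(congr1 (@fpsC F)) : (m + n).+1%:R / ('C((m + n).+1, n.+1))%:R =
    n.+1%:R / ('C(m + n, n))%:R :> F.
  have b k l : 'C(k + l, l)%:R != 0 :> F by rewrite pnatr_eq0 -lt0n bin_gt0 leq_addl.
  have := b m n.+1; rewrite addnS => b1.
  by apply/eqP; rewrite eqr_div ?b // -!natrM (mul_bin_diag (m + n).+1).
rewrite !rmorphM !rmorph_nat => H; apply: (@fps_natr_inj n).
rewrite /connector addnS.
transitivity (('C((m + n).+1, n.+1)%:R^-1)%:S * poch m *
   (n.+1%:R * poch n.+1) * (nsubt (m + n).+1 * pochV (m + n).+1)); first ring.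
rewrite pochS pochVS.
transitivity (((m + n).+1%:R * ('C((m + n).+1, n.+1)%:R^-1)%:S) * poch m *
   (nsubt n.+1 * poch n) * pochV (m + n)); first ring.
by rewrite H; ring.
Qed.

Lemma connectorSl m n :
  nsubt (m + n).+1 * connector m.+1 n = nsubt m.+1 * connector m n.
Proof. by rewrite connectorC addnC connectorSr connectorC. Qed.

Lemma nsubtD m n : nsubt (m + n) = nsubt m + n%:R.
Proof. by rewrite /nsubt natrD; ring. Qed.

Lemma connector_x m n :
  nsubt n.+1 * (connector m n - connector m n.+1) = m%:R * connector m n.+1.
Proof.
rewrite mulrBr -connectorSr -mulrBl; congr (_ * _).
by rewrite -addnS addnC nsubtD; ring.
Qed.

Lemma connector_e m n :
  nsubt m * connector m n.+1 = nsubt n.+1 * connector m n - n.+1%:R * connector m n.+1.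
Proof. by rewrite -connectorSr -addnS nsubtD; ring. Qed.

Lemma connector_shift m n :
  nsubt m.+1 * connector m n.+1 = nsubt n.+1 * connector m.+1 n.
Proof. by rewrite -connectorSr -connectorSl addnS addSn. Qed.

(** * Connected sums and the transport of one letter, with boundary terms *)

Definition csum N f n : fps F := \sum_(m < N.+1) f m * connector m n.

Definition cpair N f g : fps F := \sum_(n < N.+1) csum N f n * g n.

Lemma cpairC N f g : cpair N f g = cpair N g f.
Proof.
rewrite /cpair /csum; under eq_bigr do rewrite mulr_suml.
rewrite exchange_big; apply: eq_bigr => m _; rewrite mulr_suml.
by apply: eq_bigr => n _; rewrite connectorC; ring.
Qed.

(** Summation by parts with variable coefficients; the lower boundary term vanishes because h 0 =
    0. *)
Lemma abel_sum N f g h (a b q : nat -> fps F) (z : fps F) :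
    h 0%N = 0 ->
    (forall n, z * g n = a n * h n - b n.+1 * h n.+1) ->
    (forall n, a n.+1 * f n.+1 - b n.+1 * f n = z * q n.+1) ->
  z * (\sum_(n < N.+1) f n * g n - \sum_(n < N.+1) q n * h n) =
  - (b N.+1 * h N.+1 * f N).
Proof.
move=> h0 gE fE; rewrite -sumrB mulr_sumr.
elim: N => [|N IHN].
  rewrite big_ord1 h0 mulr0 subr0 mulrCA gE h0; ring.
rewrite big_ord_recr /= IHN mulrBr.
rewrite [z * (_ * g _)]mulrCA gE [z * (_ * h _)]mulrA -fE; ring.
Qed.

(** Here f is f' with x appended, so f' belongs to the shorter word, and h is g with e_1 appended.
    By [connector_x] the factor m between f and f' becomes a difference in n, which summation by
    parts transfers to h. *)
Lemma cpair_x N f f' g h :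
    f' 0%N = 0 -> (forall n, n%:R * f n = f' n) ->
    h 0%N = 0 -> (forall n, nsubt n.+1 * h n.+1 = nsubt n * h n + g n) ->
  cpair N f g - cpair N f' h = nsubt N.+1 * h N.+1 * csum N f N.
Proof.
move=> f0 ff' h0 hE; pose a n := - nsubt n.
have /(@abel_sum N (csum N f) g h a a (csum N f') 1)/(_ _ _) H := h0.
rewrite -[LHS]mul1r H.
- by rewrite /a; ring.
- by move=> n; rewrite /a -[g n](addKr (nsubt n * h n)) -hE; ring.
move=> n; rewrite /a mul1r.
have -> : - nsubt n.+1 * csum N f n.+1 - - nsubt n.+1 * csum N f n =
  nsubt n.+1 * (csum N f n - csum N f n.+1) by ring.
rewrite -sumrB mulr_sumr; apply: eq_bigr => m _.
by rewrite -mulrBr mulrCA connector_x -ff'; ring.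
Qed.

(* The recurrence for [f'] says that it is obtained from [f] by appending the
   letter e_z; the one for [h] that it is obtained from [g] by appending the
   dual of e_z. For z = 1, the latter reads g n = n h n. *)
Lemma cpair_e N (z : F) f f' g h :
    f' 0%N = 0 ->
    (forall n, nsubt n.+1 * f' n.+1 = z%:S * (nsubt n * f' n + f n)) ->
    h 0%N = 0 ->
    (forall n, z%:S * g n = z%:S * (n%:R * h n) - (z - 1)%:S * (nsubt n.+1 * h n.+1)) ->
  z%:S * (cpair N f' g - cpair N f h) =
    - ((z - 1)%:S * (nsubt N.+1 * h N.+1 * csum N f' N)
       + \sum_(n < N) nsubt n.+1 * h n.+1 * connector N.+1 n * f' N.+1).
Proof.
move=> f0 f'E h0 hE.
(* Both sides evaluate the sum over m <= N of (m+1-t) f'(m+1) C(m,n+1): the left by the recurrence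
   of f' and [connector_e], the right by [connector_shift]. The shift of m reaches N+1, outside
   [csum N f']. *)
have key n : z%:S * (nsubt n.+1 * csum N f' n - n.+1%:R * csum N f' n.+1 + csum N f n.+1)
    = nsubt n.+1 * (csum N f' n + connector N.+1 n * f' N.+1).
  transitivity (\sum_(m < N.+1) nsubt m.+1 * f' m.+1 * connector m n.+1).
    rewrite !mulr_sumr -sumrB -big_split mulr_sumr /=; apply: eq_bigr => m _.
    rewrite f'E; move: (connector_e m n) => E.
    transitivity (z%:S * (f' m * (nsubt n.+1 * connector m n - n.+1%:R * connector m n.+1) +
     f m * connector m n.+1)); first by ring.
    by rewrite -E; ring.
  have -> : csum N f' n + connector N.+1 n * f' N.+1 =
      \sum_(m < N.+2) f' m * connector m n by rewrite big_ord_recr /= [X in _ + X]mulrC.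
  rewrite [in RHS]big_ord_recl /= f0 mul0r add0r mulr_sumr; apply: eq_bigr => m _.
  by rewrite [RHS]mulrCA -connector_shift; ring.
(* The overhang at m = N+1, indexed one step late because [abel_sum] reads [key n] as a statement
   about [q n.+1]. Its value at 0 is harmless: it only meets h 0 = 0. *)
pose r n := connector N.+1 n.-1 * f' N.+1.
pose q n := z%:S * csum N f n - nsubt n * r n.
have H := @abel_sum N (csum N f') (fun n => z%:S * g n) h (fun n => z%:S * n%:R)
  (fun n => (z - 1)%:S * nsubt n) q 1 h0.
have {}H : \sum_(n < N.+1) csum N f' n * (z%:S * g n) - \sum_(n < N.+1) q n * h n =
   - ((z - 1)%:S * nsubt N.+1 * h N.+1 * csum N f' N).
  rewrite -[LHS]mul1r H // => n; first by rewrite mul1r hE; ring.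
  rewrite mul1r /q /r /=; move: (key n); rewrite rmorphB rmorph1 => E.
  apply/eqP; rewrite -subr_eq0; apply/eqP.
  transitivity (nsubt n.+1 * (csum N f' n + connector N.+1 n * f' N.+1) -
   z%:S * (nsubt n.+1 * csum N f' n - n.+1%:R * csum N f' n.+1 + csum N f n.+1)).
    by ring.
  by rewrite -E subrr.
have -> : \sum_(n < N) nsubt n.+1 * h n.+1 * connector N.+1 n * f' N.+1 =
   \sum_(n < N.+1) nsubt n * h n * r n.
  rewrite [in RHS]big_ord_recl /= h0 mulr0 mul0r add0r; apply: eq_bigr => n _.
  by rewrite /r /bump /= add1n; ring.
rewrite opprD [X in - X - _](_ : _ =
   (z - 1)%:S * nsubt N.+1 * h N.+1 * csum N f' N); last by ring.
rewrite -H mulrBr !mulr_sumr -!sumrB.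
by apply: eq_bigr => n _; rewrite /q; ring.
Qed.

End Connector.

(** * Harmonic sums as logarithms *)

Section Polylog.
Variable R : realType.
Implicit Types (m n N p k : nat).

(** Stands for log n. The extra 1 keeps it at least 1 even at n = 0, so exponents can be raised in
    upper bounds. *)
Definition harm1 n : R := 1 + \sum_(i < n) i.+1%:R^-1.
Local Notation ell := harm1.

Lemma harm1S n : ell n.+1 = ell n + n.+1%:R^-1.
Proof. by rewrite /ell big_ord_recr /= addrA. Qed.

Lemma harm1_ge1 n : 1 <= ell n.
Proof. by rewrite lerDl sumr_ge0 // => i _; rewrite invr_ge0. Qed.

Lemma harm1_ge0 n : 0 <= ell n.
Proof. exact: le_trans ler01 (harm1_ge1 n). Qed.

Lemma harm1D m n : ell (m + n) <= ell m + ell n.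
Proof.
elim: n => [|n IHn]; first by rewrite addn0 lerDl harm1_ge0.
rewrite addnS !harm1S addrA lerD // lef_pV2 ?posrE ?ltr0n // ler_nat ltnS.
exact: leq_addl.
Qed.

Lemma harm1_le m n : (m <= n)%N -> ell m <= ell n.
Proof.
by move/subnK <-; elim: (n - m)%N => // k IHk; rewrite addSn harm1S ler_wpDr ?invr_ge0.
Qed.

Lemma harm1S_le n : ell n.+1 <= 2 * ell n.
Proof.
rewrite harm1S mulr_natl mulr2n lerD2l; apply: le_trans (harm1_ge1 n).
by rewrite invf_le1 ?ltr0n // ler1n.
Qed.

Lemma sum_harm1_le m : \sum_(i < m) i.+1%:R^-1 <= ell m.
Proof. by rewrite lerDr. Qed.

(** A discrete derivative of the (p+1)-st power of the logarithm. *)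
Lemma harm1X_diff p n : ell n.+1 ^+ p.+1 - ell n ^+ p.+1
  <= p.+1%:R * ell n.+1 ^+ p / n.+1%:R.
Proof.
have le_nn : ell n <= ell n.+1 by exact: harm1_le.
elim: p => [|p IHp]; first by rewrite !expr1 expr0 mulr1 mul1r harm1S addrC addKr.
rewrite exprS [X in _ - X]exprS.
have -> : ell n.+1 * ell n.+1 ^+ p.+1 - ell n * ell n ^+ p.+1 =
    ell n.+1 * (ell n.+1 ^+ p.+1 - ell n ^+ p.+1) +
    ell n ^+ p.+1 * (ell n.+1 - ell n) by ring.
have -> : p.+2%:R * ell n.+1 ^+ p.+1 / n.+1%:R =
    ell n.+1 * (p.+1%:R * ell n.+1 ^+ p / n.+1%:R) + ell n.+1 ^+ p.+1 / n.+1%:R.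
  by rewrite exprS -[p.+2]addn1 natrD; ring.
apply: lerD; first by rewrite ler_wpM2l ?harm1_ge0.
rewrite (_ : _ - _ = n.+1%:R^-1); last by rewrite harm1S addrC addKr.
rewrite ler_wpM2r ?invr_ge0 //.
by rewrite lerXn2r ?nnegrE ?harm1_ge0.
Qed.

(** As 1/((n+1)(n+2)) = 1/(n+1) - 1/(n+2), summation by parts lowers p by one. Keeping the boundary
    term makes the induction telescope, and [harm1_cvg0] uses it. *)
Lemma harm1_bound p : exists B : R, forall N,
  \sum_(n < N) ell n ^+ p / (n.+1%:R * n.+2%:R) + ell N ^+ p / N.+1%:R <= B.
Proof.
elim: p => [|p [B HB]].
  exists 1 => N; elim: N => [|N IHN]; first by rewrite big_ord0 add0r divr1.
  apply: le_trans IHN; rewrite big_ord_recr /= -addrA lerD2l !expr0 !mul1r.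
  rewrite le_eqVlt; apply/orP; left; apply/eqP.
  rewrite -[N.+2%:R]natr1; have := ltr0Sn R N; move: N.+1%:R => a a0.
  by field; rewrite !gt_eqF // addr_gt0.
(* The 1 is the left-hand side at N = 0; (p+1) 2^p comes from [harm1X_diff] followed by
   [harm1S_le]. *)
exists (1 + p.+1%:R * 2 ^+ p * B) => N.
apply: (@le_trans _ _ (1 + p.+1%:R * 2 ^+ p *
    \sum_(n < N) ell n ^+ p / (n.+1%:R * n.+2%:R))); last first.
  rewrite lerD2l ler_wpM2l ?mulr_ge0 ?exprn_ge0 //.
  apply: le_trans (HB N); rewrite lerDl mulr_ge0 ?invr_ge0 // exprn_ge0 //.
  exact: harm1_ge0.
elim: N => [|N IHN].
  by rewrite !big_ord0 mulr0 addr0 add0r divr1 /ell big_ord0 addr0 expr1n.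
rewrite !big_ord_recr /=.
rewrite [leRHS](_ : _ = 1 + p.+1%:R * 2 ^+ p *
    (\sum_(i < N) ell i ^+ p / (i.+1%:R * i.+2%:R)) +
    p.+1%:R * 2 ^+ p * (ell N ^+ p / (N.+1%:R * N.+2%:R))); last by ring.
have -> : \sum_(i < N) ell i ^+ p.+1 / (i.+1%:R * i.+2%:R) +
    ell N ^+ p.+1 / (N.+1%:R * N.+2%:R) + ell N.+1 ^+ p.+1 / N.+2%:R =
    (\sum_(i < N) ell i ^+ p.+1 / (i.+1%:R * i.+2%:R) + ell N ^+ p.+1 / N.+1%:R)
    + (ell N.+1 ^+ p.+1 - ell N ^+ p.+1) / N.+2%:R.
  rewrite -[N.+2%:R]natr1; have := ltr0Sn R N; move: N.+1%:R => a a0.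
  by field; rewrite !gt_eqF // addr_gt0.
apply: lerD => //; rewrite invfM !mulrA ler_wpM2r ?invr_ge0 //.
apply: le_trans (harm1X_diff p N) _; rewrite ler_wpM2r ?invr_ge0 //.
rewrite -mulrA ler_wpM2l // -exprMn lerXn2r ?nnegrE ?mulr_ge0 ?harm1_ge0 //.
exact: harm1S_le.
Qed.

(** The square of the n-th term is at most B/(n+1), by the boundary part of [harm1_bound] at
    exponent 2p. *)
Lemma harm1_cvg0 p : (ell n ^+ p / n.+1%:R @[n --> \oo] --> (0 : R))%classic.
Proof.
have [B HB] := harm1_bound (p * 2)%N.
have {}HB n : ell n ^+ (p * 2) / n.+1%:R <= B.
  apply: le_trans (HB n); rewrite lerDr sumr_ge0 // => i _.
  by rewrite mulr_ge0 ?invr_ge0 ?mulr_ge0 // exprn_ge0 ?harm1_ge0.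
apply/cvgrPdist_lt => e e0.
have B0 : 0 <= B.
  by apply: le_trans (HB 0%N); rewrite mulr_ge0 ?invr_ge0 // exprn_ge0 ?harm1_ge0.
have [n0 Hn0] : exists n0, B / e ^+ 2 < n0%:R.
  by exists (Num.bound (B / e ^+ 2)); rewrite archi_boundP // divr_ge0 ?exprn_ge0 ?(ltW e0).
exists n0 => // n /= n0n; rewrite sub0r normrN ger0_norm; last first.
  by rewrite mulr_ge0 ?invr_ge0 // exprn_ge0 ?harm1_ge0.
rewrite -(@ltr_pXn2r _ 2) ?nnegrE ?(ltW e0) //; last first.
  by rewrite mulr_ge0 ?invr_ge0 // exprn_ge0 ?harm1_ge0.
rewrite exprMn -exprM expr2 mulrA.
apply: le_lt_trans (_ : B / n.+1%:R < _); first by rewrite ler_wpM2r ?invr_ge0.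
rewrite ltr_pdivrMr ?ltr0n // mulrC -ltr_pdivrMr ?exprn_gt0 //.
by apply: lt_le_trans Hn0 _; rewrite ler_nat leqW.
Qed.

(** The norm of [R[i]] is valued in [R[i]]; taking its real part moves the estimates to R. *)
Definition nc (x : R[i]) : R := complex.Re `|x|.

Lemma ncE x : (nc x)%:C = `|x|.
Proof. by []. Qed.

Lemma nc_ge0 x : 0 <= nc x.
Proof. by rewrite -lecR ncE; exact: normr_ge0. Qed.
Lemma nc0 : nc 0 = 0.
Proof. by apply: complexI; rewrite ncE normr0. Qed.
Lemma nc1 : nc 1 = 1.
Proof. by apply: complexI; rewrite ncE normr1. Qed.
Lemma ncM : {morph nc : x y / x * y}.
Proof. by move=> x y; apply: complexI; rewrite rmorphM /= !ncE normrM. Qed.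
Lemma ncV x : nc x^-1 = (nc x)^-1.
Proof. by apply: complexI; rewrite fmorphV /= !ncE normfV. Qed.
Lemma ncX x n : nc (x ^+ n) = nc x ^+ n.
Proof. by apply: complexI; rewrite rmorphXn /= !ncE normrX. Qed.
Lemma ncN x : nc (- x) = nc x.
Proof. by apply: complexI; rewrite !ncE normrN. Qed.
Lemma nc_nat n : nc n%:R = n%:R.
Proof. by apply: complexI; rewrite ncE rmorph_nat normr_nat. Qed.
Lemma ncD x y : nc (x + y) <= nc x + nc y.
Proof. by rewrite -lecR rmorphD /= !ncE ler_normD. Qed.
Lemma ncB x y : nc (x - y) <= nc x + nc y.
Proof. by rewrite -(ncN y) ncD. Qed.
Lemma nc_sum I (r : seq I) (P : pred I) (G : I -> R[i]) :
  nc (\sum_(i <- r | P i) G i) <= \sum_(i <- r | P i) nc (G i).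
Proof.
elim/big_rec2: _ => [|i y x _ IH]; first by rewrite nc0.
by apply: le_trans (ncD _ _) _; rewrite lerD2l.
Qed.

(** * Norms modulo t^K and decay of the boundary terms *)

Section TruncatedNorm.
Variable K : nat.
Implicit Types (f g h : nat -> fps R[i]).

(* Submultiplicative, being the l^1 norm on R[i][t]/(t^K). *)
Definition fnorm (x : fps R[i]) : R := \sum_(k < K) nc (x k).

Lemma fnorm_ge0 x : 0 <= fnorm x.
Proof. by apply: sumr_ge0 => k _; exact: nc_ge0. Qed.

Lemma fnorm0 : fnorm 0 = 0.
Proof. by rewrite /fnorm big1 // => k _; rewrite coeft0 nc0. Qed.

Lemma fnormD x y : fnorm (x + y) <= fnorm x + fnorm y.
Proof. by rewrite -big_split; apply: ler_sum => k _; exact: ncD. Qed.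

Lemma fnormN x : fnorm (- x) = fnorm x.
Proof. by apply: eq_bigr => k _; rewrite coeftN ncN. Qed.

Lemma fnorm_sum I (r : seq I) (P : pred I) (G : I -> fps R[i]) :
  fnorm (\sum_(i <- r | P i) G i) <= \sum_(i <- r | P i) fnorm (G i).
Proof.
elim/big_rec2: _ => [|i y x _ IH]; first by rewrite fnorm0.
by apply: le_trans (fnormD _ _) _; rewrite lerD2l.
Qed.

Lemma fnormM x y : fnorm (x * y) <= fnorm x * fnorm y.
Proof.
rewrite /fnorm mulr_suml.
apply: (@le_trans _ _
    (\sum_(k < K) \sum_(i < K | (i <= k)%N) nc (x i) * nc (y (k - i)%N))).
  apply: ler_sum => k _; rewrite coeftM; apply: le_trans (nc_sum _ _ _) _.
  rewrite le_eqVlt; apply/orP; left; apply/eqP.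
  under [LHS]eq_bigr do rewrite ncM.
  by rewrite (big_ord_widen K (fun i => nc (x i) * nc (y (k - i)%N))).
under eq_bigr do rewrite big_mkcond.
rewrite exchange_big /=; apply: ler_sum => i _; rewrite -big_mkcond /= -mulr_sumr.
rewrite ler_wpM2l ?nc_ge0 //.
have -> : \sum_(k < K | (i <= k)%N) nc (y (k - i)%N) = \sum_(j < K - i) nc (y j).
  rewrite -(big_geq_mkord i K xpredT (fun k => nc (y (k - i)%N))).
  rewrite -{1}[nat_of_ord i]add0n big_addn big_mkord.
  by apply: eq_bigr => j _; rewrite addnK.
rewrite [leRHS](bigID (fun j : 'I_K => (j < K - i)%N)) /=.
rewrite -(big_ord_widen K (fun j => nc (y j)) (leq_subr _ _)) lerDl.
by apply: sumr_ge0 => j _; exact: nc_ge0.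
Qed.

Lemma fnormCM a x : fnorm (fpsC a * x) = nc a * fnorm x.
Proof. by rewrite /fnorm mulr_sumr; apply: eq_bigr => k _; rewrite coeftCM ncM. Qed.

Lemma fnorm_nsubt n : fnorm (nsubt _ n.+1) <= n.+2%:R.
Proof.
rewrite /nsubt; apply: le_trans (fnormD _ _) _; rewrite fnormN -[n.+2]addn1 natrD.
apply: lerD.
  rewrite -(rmorph_nat (@fpsC _)) /fnorm; case: K => [|k]; first by rewrite big_ord0.
  rewrite big_ord_recl big1 ?addr0 /= ?nc_nat // => i _; exact: nc0.
rewrite /fnorm; case: K => [|[|k]]; first by rewrite big_ord0.
  by rewrite big_ord1 /= nc0.
by rewrite 2!big_ord_recl big1 /= ?nc0 ?nc1 ?add0r ?addr0 // => i _; exact: nc0.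
Qed.

(** The coefficient is, up to sign, the elementary symmetric function of degree k in 1, 1/2, ...,
    1/n; for [coef_pochV] it is the complete one. Both are at most the k-th power of the harmonic
    sum. *)
Lemma coef_poch n k : nc (poch _ n k) <= harm1 n ^+ k.
Proof.
elim: n k => [|n IHn] k.
  rewrite /poch big_ord0; case: k => [|k] /=; rewrite ?nc1 ?expr0 // nc0.
  by rewrite exprn_ge0 // harm1_ge0.
have -> : poch R[i] n.+1 = poch _ n - poch _ n * fpsC n.+1%:R^-1 * fpsT.
  by rewrite /poch big_ord_recr /=; ring.
rewrite coeftB coeftMT; case: k => [|k]; first by rewrite subr0 expr0; exact: (IHn 0%N).
rewrite coeftMC; apply: le_trans (ncB _ _) _; rewrite ncM ncV nc_nat.
rewrite exprSr harm1S mulrDr -harm1S.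
have le_nn : harm1 n <= harm1 n.+1 by exact: harm1_le.
have hX j : harm1 n ^+ j <= harm1 n.+1 ^+ j.
  by rewrite lerXn2r ?nnegrE ?harm1_ge0.
apply: lerD.
  by apply: le_trans (IHn _) _; rewrite exprSr ler_wpM2r ?harm1_ge0.
by rewrite ler_wpM2r ?invr_ge0 //; apply: le_trans (IHn _) (hX _).
Qed.

Lemma coef_pochV n k : nc (pochV _ n k) <= harm1 n ^+ k.
Proof.
elim: n k => [|n IHn] k.
  rewrite /pochV big_ord0; case: k => [|k] /=; rewrite ?nc1 ?expr0 // nc0.
  by rewrite exprn_ge0 // harm1_ge0.
have le_nn : harm1 n <= harm1 n.+1 by exact: harm1_le.
have hX j : harm1 n ^+ j <= harm1 n.+1 ^+ j.
  by rewrite lerXn2r ?nnegrE ?harm1_ge0.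
have E : pochV R[i] n.+1 = pochV _ n + pochV _ n.+1 * fpsC n.+1%:R^-1 * fpsT.
  rewrite /pochV big_ord_recr /= -/(pochV _ n); set G := fps_geom _.
  have := fps_geomVl (n.+1%:R^-1 : R[i]); rewrite -/G => GE.
  rewrite -[X in _ = X + _]mulr1 -[X in _ = _ * X + _]GE; ring.
elim: k => [|k IHk]; rewrite E coeftD coeftMT.
  by rewrite addr0 expr0; exact: (IHn 0%N).
rewrite coeftMC; apply: le_trans (ncD _ _) _; rewrite ncM ncV nc_nat.
rewrite exprSr harm1S mulrDr -harm1S; apply: lerD.
  by apply: le_trans (IHn _) _; rewrite exprSr ler_wpM2r ?harm1_ge0.
by rewrite ler_wpM2r ?invr_ge0.
Qed.

Lemma fnorm_harm1 n N (x : fps R[i]) : (n <= N)%N ->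
  (forall k, nc (x k) <= harm1 n ^+ k) -> fnorm x <= K%:R * harm1 N ^+ K.
Proof.
move=> nN xn; rewrite mulr_natl -[K in _ *+ K]card_ord -sumr_const.
apply: ler_sum => k _; apply: le_trans (xn k) _.
apply: (@le_trans _ _ (harm1 N ^+ k)).
  by rewrite lerXn2r ?nnegrE ?harm1_ge0 // harm1_le.
by rewrite ler_weXn2l ?harm1_ge1 // ltnW.
Qed.

Lemma fnorm_connector m n :
  fnorm (connector _ m n) <=
    (K%:R * harm1 (m + n) ^+ K) ^+ 3 / ('C(m + n, n))%:R.
Proof.
rewrite /connector fnormCM ncV nc_nat mulrC ler_wpM2r ?invr_ge0 //.
have H : forall x : fps R[i], (forall k, nc (x k) <= harm1 m ^+ k) \/
   (forall k, nc (x k) <= harm1 n ^+ k) \/ (forall k, nc (x k) <= harm1 (m + n) ^+ k) ->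
   fnorm x <= K%:R * harm1 (m + n) ^+ K.
  move=> x [|[]]; apply: fnorm_harm1; rewrite ?leq_addr ?leq_addl //.
rewrite exprSr; apply: le_trans (fnormM _ _) _; apply: ler_pM; rewrite ?fnorm_ge0 //.
  rewrite expr2; apply: le_trans (fnormM _ _) _; apply: ler_pM; rewrite ?fnorm_ge0 //.
    by apply: H; left => k; exact: coef_poch.
  by apply: H; right; left => k; exact: coef_poch.
by apply: H; right; right => k; exact: coef_pochV.
Qed.

(** The first argument is m+1 because C(0, n) = 1 does not decay in n. *)
Lemma bin_ge m n : (n < 'C(m.+1 + n, n))%N.
Proof.
elim: m => [|m IHm]; first by rewrite add1n binSn.
by apply: leq_trans IHm _; rewrite addSn leq_bin2l.
Qed.

(** The exponent is existential, so that the class absorbs sums and further logarithms. *)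
Definition decays f := exists C p, 0 <= C /\
  forall m, fnorm (f m) <= C * harm1 m ^+ p / m.+1%:R.

Lemma decaysD f g : decays f -> decays g -> decays (fun n => f n + g n).
Proof.
move=> [C [p [C0 Hf]]] [D [q [D0 Hg]]]; exists (C + D), (p + q)%N; split.
  exact: addr_ge0.
move=> m; apply: le_trans (fnormD _ _) _; rewrite !mulrDl; apply: lerD.
  apply: le_trans (Hf m) _; rewrite ler_wpM2r ?invr_ge0 // ler_wpM2l //.
  by rewrite ler_weXn2l ?harm1_ge1 ?leq_addr.
apply: le_trans (Hg m) _; rewrite ler_wpM2r ?invr_ge0 // ler_wpM2l //.
by rewrite ler_weXn2l ?harm1_ge1 ?leq_addl.
Qed.

Lemma decaysC a f : decays f -> decays (fun n => fpsC a * f n).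
Proof.
move=> [C [p [C0 Hf]]]; exists (nc a * C), p; split; first by rewrite mulr_ge0 ?nc_ge0.
by move=> m; rewrite fnormCM -!mulrA ler_wpM2l ?nc_ge0 // mulrA.
Qed.

Lemma decays_nsubt f : decays f -> exists C p, 0 <= C /\
  forall n N, (n <= N)%N -> fnorm (nsubt _ n.+1 * f n.+1) <= C * harm1 N.+1 ^+ p.
Proof.
move=> [C [p [C0 Hf]]]; exists C, p; split => // n N nN.
apply: le_trans (fnormM _ _) _.
apply: le_trans (ler_pM (fnorm_ge0 _) (fnorm_ge0 _) (fnorm_nsubt _) (Hf _)) _.
rewrite mulrC divfK ?pnatr_eq0 // ler_wpM2l // lerXn2r ?nnegrE ?harm1_ge0 //.
by rewrite harm1_le.
Qed.

Lemma decays_le (G : nat -> fps R[i]) C p q : 0 <= C ->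
  (forall N, fnorm (G N) <= C * (q%:R * harm1 N) ^+ p / N.+1%:R) -> decays G.
Proof.
move=> C0 H; exists (C * q%:R ^+ p), p; split; first by rewrite mulr_ge0 // exprn_ge0.
by move=> N; rewrite -[C * _ * _]mulrA -exprMn.
Qed.

(** Since f 0 = 0, the sum starts at m = 1, where the inverse binomial supplies 1/(N+1); what
    remains of the sum over m is logarithmic. *)
Lemma decays_csum f h : f 0%N = 0 -> decays f -> decays h ->
  decays (fun N => nsubt _ N.+1 * h N.+1 * csum N f N).
Proof.
move=> f0 [C [p [C0 Hf]]] /decays_nsubt[D [q [D0 Hh]]].
(* The exponents are q from h, p from f, 3K from the connector and one from the harmonic sum. The 2
   covers both [harm1 (m + N)] and [harm1 N.+1]. *)
apply: (@decays_le _ (D * (C * K%:R ^+ 3)) (q + (p + K * 3).+1) 2).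
  by rewrite !mulr_ge0 // exprn_ge0.
move=> N; set l := (2%:R * harm1 N).
have l1 : 1 <= l by have := harm1_ge1 N; rewrite /l; lra.
have l0 : 0 <= l by exact: le_trans l1.
have lN : harm1 N <= l by have := harm1_ge0 N; rewrite /l; lra.
have lS : harm1 N.+1 <= l by exact: harm1S_le.
apply: le_trans (fnormM _ _) _.
rewrite [leRHS](_ : _ = D * l ^+ q * (C * K%:R ^+ 3 * l ^+ (p + K * 3).+1 / N.+1%:R)).
  2: by rewrite exprD; ring.
apply: ler_pM; rewrite ?fnorm_ge0 //.
  apply: le_trans (Hh _ _ (leqnn N)) _; rewrite ler_wpM2l //.
  by rewrite lerXn2r ?nnegrE ?harm1_ge0.
apply: le_trans (fnorm_sum _ _ _) _.
apply: (@le_trans _ _ (\sum_(m < N.+1 | (0 < m)%N)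
   C * l ^+ p / m.+1%:R * ((K%:R * l ^+ K) ^+ 3 / N.+1%:R))).
  rewrite [leRHS]big_mkcond /=; apply: ler_sum => m _; case: posnP => [->|m0].
    by rewrite f0 mul0r fnorm0.
  apply: le_trans (fnormM _ _) _; apply: ler_pM; rewrite ?fnorm_ge0 //.
    apply: le_trans (Hf m) _; rewrite ler_wpM2r ?invr_ge0 // ler_wpM2l //.
    rewrite lerXn2r ?nnegrE ?harm1_ge0 //; apply: le_trans lN.
    by rewrite harm1_le // -ltnS.
  apply: le_trans (fnorm_connector _ _) _; apply: ler_pM.
  - by rewrite !exprn_ge0 // mulr_ge0 // exprn_ge0 ?harm1_ge0.
  - by rewrite invr_ge0.
  - rewrite lerXn2r ?nnegrE ?mulr_ge0 ?exprn_ge0 ?harm1_ge0 //.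
    rewrite ler_wpM2l // lerXn2r ?nnegrE ?harm1_ge0 //.
    apply: le_trans (harm1D _ _) _; rewrite /l mulr_natl mulr2n lerD2r.
    by rewrite harm1_le // -ltnS.
  rewrite lef_pV2 ?posrE ?ltr0n ?bin_gt0 ?leq_addl // ler_nat.
  by rewrite -(prednK m0) bin_ge.
rewrite -mulr_suml -mulr_sumr.
have -> : C * K%:R ^+ 3 * l ^+ (p + K * 3).+1 / N.+1%:R =
    C * l ^+ p * l * ((K%:R * l ^+ K) ^+ 3 / N.+1%:R).
  by rewrite [(K%:R * _) ^+ 3]exprMn -exprM [l ^+ _.+1]exprS exprD; ring.
rewrite ler_wpM2r ?mulr_ge0 ?invr_ge0 ?exprn_ge0 ?mulr_ge0 ?exprn_ge0 ?harm1_ge0 //.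
rewrite ler_wpM2l ?mulr_ge0 ?exprn_ge0 ?mulr_ge0 ?harm1_ge0 //; apply: le_trans lS.
apply: le_trans (sum_harm1_le _); rewrite big_mkcond; apply: ler_sum => m _.
by case: ifP => // _; rewrite invr_ge0.
Qed.

(** The roles are reversed: f(N+1) supplies 1/(N+1), and the inverse binomial supplies 1/(n+1),
    whose sum over n costs one logarithm. *)
Lemma decays_connector f h : decays f -> decays h ->
  decays (fun N => \sum_(n < N) nsubt _ n.+1 * h n.+1 * connector _ N.+1 n * f N.+1).
Proof.
move=> [C [p [C0 Hf]]] /decays_nsubt[D [q [D0 Hh]]].
(* The 3 bounds [harm1 (N.+1 + n)]: two from [harm1 N.+1] and one from [harm1 n]. *)
apply: (@decays_le _ (D * (C * K%:R ^+ 3)) (q + (p + K * 3).+1) 3).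
  by rewrite !mulr_ge0 // exprn_ge0.
move=> N; set l := (3%:R * harm1 N).
have l1 : 1 <= l by have := harm1_ge1 N; rewrite /l; lra.
have l0 : 0 <= l by exact: le_trans l1.
have lN : harm1 N <= l by have := harm1_ge0 N; rewrite /l; lra.
have lS : harm1 N.+1 <= l.
  by have := harm1S_le N; have := harm1_ge0 N; rewrite /l; lra.
apply: le_trans (fnorm_sum _ _ _) _.
apply: (@le_trans _ _ (\sum_(n < N) D * l ^+ q * ((K%:R * l ^+ K) ^+ 3 / n.+1%:R)
   * (C * l ^+ p / N.+1%:R))).
  apply: ler_sum => n _.
  apply: le_trans (fnormM _ _) _; apply: ler_pM; rewrite ?fnorm_ge0 //; last first.
    apply: le_trans (Hf _) _; apply: ler_pM.
    - by rewrite mulr_ge0 // exprn_ge0 // harm1_ge0.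
    - by rewrite invr_ge0.
    - by rewrite ler_wpM2l // lerXn2r ?nnegrE ?harm1_ge0.
    by rewrite lef_pV2 ?posrE ?ltr0n // ler_nat.
  apply: le_trans (fnormM _ _) _; apply: ler_pM; rewrite ?fnorm_ge0 //.
    apply: le_trans (Hh n N (ltnW (ltn_ord n))) _; rewrite ler_wpM2l //.
    by rewrite lerXn2r ?nnegrE ?harm1_ge0.
  apply: le_trans (fnorm_connector _ _) _; apply: ler_pM.
  - by rewrite !exprn_ge0 // mulr_ge0 // exprn_ge0 ?harm1_ge0.
  - by rewrite invr_ge0.
  - rewrite lerXn2r ?nnegrE ?mulr_ge0 ?exprn_ge0 ?harm1_ge0 //.
    rewrite ler_wpM2l // lerXn2r ?nnegrE ?harm1_ge0 //.
    apply: le_trans (harm1D _ _) _.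
    have := harm1S_le N; have := @harm1_le n N (ltnW (ltn_ord n)).
    by rewrite /l; lra.
  rewrite lef_pV2 ?posrE ?ltr0n ?bin_gt0 ?leq_addl // ler_nat.
  exact: bin_ge.
rewrite -mulr_suml -mulr_sumr -mulr_sumr.
have -> : D * (C * K%:R ^+ 3) * l ^+ (q + (p + K * 3).+1) / N.+1%:R =
    D * l ^+ q * ((K%:R * l ^+ K) ^+ 3 * l) * (C * l ^+ p / N.+1%:R).
  by rewrite [(K%:R * _) ^+ 3]exprMn -exprM exprD [l ^+ _.+1]exprS exprD; ring.
rewrite ler_wpM2r ?mulr_ge0 ?invr_ge0 ?exprn_ge0 ?mulr_ge0 ?exprn_ge0 ?harm1_ge0 //.
rewrite ler_wpM2l ?mulr_ge0 ?exprn_ge0 ?mulr_ge0 ?harm1_ge0 //.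
rewrite ler_wpM2l ?exprn_ge0 ?mulr_ge0 ?exprn_ge0 ?mulr_ge0 ?harm1_ge0 //.
by apply: le_trans lN; exact: sum_harm1_le.
Qed.

Lemma decays_cvg0 f k : (k < K)%N -> decays f ->
  (nc (f N k) @[N --> \oo] --> (0 : R))%classic.
Proof.
move=> kK [C [p [C0 Hf]]].
have : ((C * (harm1 N ^+ p / N.+1%:R)) @[N --> \oo] --> (C * 0 : R))%classic.
  by apply: cvgM; [exact: cvg_cst | exact: harm1_cvg0].
rewrite mulr0; apply: squeeze_cvgr; last exact: cvg_cst.
apply: nearW => N; rewrite nc_ge0 /= mulrA; apply: le_trans (Hf N).
rewrite /fnorm (bigD1 (Ordinal kK)) //= lerDl; apply: sumr_ge0 => j _.
exact: nc_ge0.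
Qed.
End TruncatedNorm.
End Polylog.

(** * Chain sums of words and series, and their recurrences *)

Section ChainSums.
Variable R : realType.
Local Notation A := (alg R).
Implicit Types (l : letter R) (f g : nat -> R[i]) (a b : A) (F G : fps A) (m n : nat).

(* If [f m] is the sum over the chains 0 < m_1 < ... < m_r = m attached to a
   word w, then [act l f] is the same for the word w l. *)
Definition act l f m : R[i] :=
  match l with
  | X => m%:R^-1 * f m
  | E z => m%:R^-1 * \sum_(a < m) bval z ^+ (m - a) * f a
  end.

(** The initial sequence is the empty chain, located at m_0 = 0; x sends it to 0, by the convention
    0^-1 = 0. *)
Definition phi (w : seq (letter R)) : nat -> R[i] :=
  foldl (fun f l => act l f) (fun m => (m == 0%N)%:R) w.

Lemma phi_rcons w l : phi (rcons w l) = act l (phi w).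
Proof. by rewrite /phi -cats1 foldl_cat. Qed.

Lemma act_sum l (I : Type) (r : seq I) (c : I -> R[i]) (f : I -> nat -> R[i]) m :
  act l (fun n => \sum_(i <- r) c i * f i n) m = \sum_(i <- r) c i * act l (f i) m.
Proof.
case: l => [|z] /=; first by rewrite mulr_sumr; apply: eq_bigr => i _; rewrite mulrCA.
under [RHS]eq_bigr do rewrite mulrCA mulr_sumr.
rewrite -mulr_sumr; congr (_ * _); rewrite exchange_big; apply: eq_bigr => a _.
by rewrite mulr_sumr; apply: eq_bigr => i _; rewrite mulrCA.
Qed.

Lemma inB_le1 (z : BB R) : nc (bval z) <= 1.
Proof.
rewrite -lecR ncE; case/orP: (bvalP z) => [/and3P[_ //]|/eqP->].
by rewrite normr1.
Qed.

Lemma invn_le m : m%:R^-1 <= 2 / m.+1%:R :> R.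
Proof.
case: m => [|m]; first by rewrite invr0 divr_ge0.
rewrite ler_pdivlMr ?ltr0n // mulrC ler_pdivrMr ?ltr0n // -natrM ler_nat.
by rewrite mul2n doubleS !ltnS -addnn leq_addr.
Qed.

(** A letter costs at most one logarithm: |z| <= 1 reduces the inner sum of e_z to a harmonic sum.
    The 2 replaces 1/m by 2/(m+1), which also covers m = 0. *)
Lemma act_bound l f C p : 0 <= C ->
  (forall m, nc (f m) <= C * harm1 R m ^+ p / m.+1%:R) ->
  forall m, nc (act l f m) <= 2 * C * harm1 R m ^+ p.+1 / m.+1%:R.
Proof.
move=> C0 Hf m.
have lp : 0 <= C * harm1 R m ^+ p by rewrite mulr_ge0 // exprn_ge0 ?harm1_ge0.
case: l => [|z] /=; rewrite ncM ncV nc_nat.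
  have V1 : m%:R^-1 <= 1 :> R.
    by case: m {lp} => [|m]; rewrite ?invr0 // invf_le1 ?ler1n ?ltr0n.
  apply: le_trans (ler_wpM2r (nc_ge0 _) V1) _; rewrite mul1r.
  apply: le_trans (Hf m) _; rewrite ler_wpM2r ?invr_ge0 //.
  have := harm1_ge1 R m; rewrite exprSr => l1.
  rewrite -[2 * C]mulrC -mulrA mulrA mulrCA -mulrA; nra.
rewrite exprSr [leRHS](_ : _ = 2 / m.+1%:R * (C * harm1 R m ^+ p * harm1 R m)).
  2: by ring.
apply: ler_pM; rewrite ?invr_ge0 ?nc_ge0 ?invn_le //.
apply: le_trans (nc_sum _ _ _) _.
apply: (@le_trans _ _ (\sum_(a < m) C * harm1 R m ^+ p * a.+1%:R^-1)).
  apply: ler_sum => a _; rewrite ncM ncX; apply: (@le_trans _ _ (nc (f a))).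
    by rewrite ler_piMl ?nc_ge0 // exprn_ile1 ?nc_ge0 ?inB_le1.
  apply: le_trans (Hf a) _; rewrite ler_wpM2r ?invr_ge0 // ler_wpM2l //.
  by rewrite lerXn2r ?nnegrE ?harm1_ge0 // harm1_le // ltnW.
by rewrite -mulr_sumr ler_wpM2l // sum_harm1_le.
Qed.

Lemma phi_bound (w : seq (letter R)) : exists C p, 0 <= C /\
  forall m, nc (phi w m) <= C * harm1 R m ^+ p / m.+1%:R.
Proof.
elim/last_ind: w => [|w l [C [p [C0 H]]]].
  exists 1, 0%N; split => // m; rewrite /phi /= nc_nat expr0 mulr1 mul1r.
  by case: m => [|m] /=; rewrite ?invr1 // invr_ge0.
exists (2 * C), p.+1; split; first by rewrite mulr_ge0.
by move=> m; rewrite phi_rcons; exact: act_bound.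
Qed.

Definition Phi a m : R[i] := mmap ratr (fun w : word R => phi w m) a.

Lemma Phi0 m : Phi 0 m = 0.
Proof. exact: raddf0. Qed.
Lemma PhiD a b m : Phi (a + b) m = Phi a m + Phi b m.
Proof. exact: raddfD. Qed.
Lemma PhiN a m : Phi (- a) m = - Phi a m.
Proof. exact: raddfN. Qed.

Lemma PhiU (w : word R) c m : Phi (mkmalgU w c) m = ratr c * phi w m.
Proof. exact: mmapU. Qed.

Lemma Phi_sum (I : Type) (r : seq I) (G : I -> A) m :
  Phi (\sum_(i <- r) G i) m = \sum_(i <- r) Phi (G i) m.
Proof. exact: raddf_sum. Qed.

Lemma Phi_mul_gen a l m : Phi (a * gen l) m = act l (Phi a) m.
Proof.
have -> : act l (Phi a) m = \sum_(w <- msupp a) ratr (mcoeff w a) * act l (phi w) m.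
  exact: act_sum.
rewrite /gen [a * _]fgmulgU Phi_sum; apply: eq_bigr => w _.
by rewrite PhiU mulr1 fmM fmU cats1 phi_rcons.
Qed.

Lemma Phi_bound a : exists C p, 0 <= C /\
  forall m, nc (Phi a m) <= C * harm1 R m ^+ p / m.+1%:R.
Proof.
suff [C [p [C0 H]]] : exists C p, 0 <= C /\ forall m,
    nc (\sum_(w <- msupp a) ratr (mcoeff w a) * phi w m) <= C * harm1 R m ^+ p / m.+1%:R.
  by exists C, p; split => // m; exact: H.
elim: (enum_fset (msupp a)) => [|w r [C [p [C0 H]]]].
  by exists 0, 0%N; split => // m; rewrite big_nil nc0 mul0r mul0r.
have [D [q [D0 Hw]]] := phi_bound w.
have l1 m := harm1_ge1 R m.
exists (C + nc (ratr (mcoeff w a)) * D), (p + q)%N; split.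
  by rewrite addr_ge0 // mulr_ge0 ?nc_ge0.
move=> m; rewrite big_cons addrC; apply: le_trans (ncD _ _) _.
rewrite !mulrDl; apply: lerD.
  apply: le_trans (H m) _; rewrite ler_wpM2r ?invr_ge0 // ler_wpM2l //.
  by rewrite ler_weXn2l ?leq_addr.
rewrite ncM -!mulrA ler_wpM2l ?nc_ge0 // mulrA; apply: le_trans (Hw m) _.
by rewrite ler_wpM2r ?invr_ge0 // ler_wpM2l // ler_weXn2l ?leq_addl.
Qed.

(** For F = [sigma_word u] this is the sequence phi_u of the connected sums; [phi] itself does not
    involve t. *)
Definition Phit F m : fps R[i] := Fps (fun k => Phi (F k) m).

Lemma PhitE F m k : Phit F m k = Phi (F k) m.
Proof. by []. Qed.

Lemma PhitD F G m : Phit (F + G) m = Phit F m + Phit G m.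
Proof. by apply/fpsP => k; exact: PhiD. Qed.

Lemma PhitN F m : Phit (- F) m = - Phit F m.
Proof. by apply/fpsP => k; exact: PhiN. Qed.

Lemma PhitMT F m : Phit (F * fpsT) m = Phit F m * fpsT.
Proof.
by apply/fpsP => -[|k]; rewrite [RHS]coeftMT !PhitE coeftMT // Phi0.
Qed.

Lemma PhitMX F m : Phit (F * fpsC (gen X)) m = fpsC m%:R^-1 * Phit F m.
Proof. by apply/fpsP => k; rewrite [RHS]coeftCM !PhitE coeftMC Phi_mul_gen. Qed.

Lemma PhitME F z m : Phit (F * fpsC (gen (E z))) m =
  fpsC m%:R^-1 * \sum_(a < m) fpsC (bval z) ^+ (m - a) * Phit F a.
Proof.
apply/fpsP => k; rewrite [RHS]coeftCM coeft_sum PhitE coeftMC Phi_mul_gen /act.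
by congr (_ * _); apply: eq_bigr => a _; rewrite -rmorphXn [RHS]coeftCM.
Qed.

Lemma fpsC_natV m : m.+1%:R * fpsC m.+1%:R^-1 = 1 :> fps R[i].
Proof.
by rewrite -(rmorph_nat (@fpsC _)) -rmorphM divff ?pnatr_eq0 // rmorph1.
Qed.

Lemma Phit_X0 F : Phit (F * fpsC (gen X)) 0 = 0.
Proof. by rewrite PhitMX invr0 rmorph0 mul0r. Qed.

Lemma Phit_X F m : Phit F 0 = 0 -> m%:R * Phit (F * fpsC (gen X)) m = Phit F m.
Proof.
move=> F0; rewrite PhitMX mulrA; case: m => [|m]; first by rewrite F0 mulr0.
by rewrite fpsC_natV mul1r.
Qed.

Lemma fps_geomE (B : nzRingType) (x : B) :
  fps_geom x = 1 + fps_geom x * fpsC x * fpsT.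
Proof. by rewrite -[X in X + _](fps_geomVl x) mulrBr mulr1 mulrA subrK. Qed.

Lemma fpsC_geomE (B : nzRingType) (F : fps B) (e x : B) :
  F * (fpsC e * fps_geom x) =
  F * fpsC e + F * (fpsC e * fps_geom x) * fpsC x * fpsT.
Proof. by rewrite [in LHS]fps_geomE !mulrDr mulr1 !mulrA. Qed.

Lemma fpsC_geom1E (B : nzRingType) (e x : B) :
  fpsC e * fps_geom x = fpsC e + fpsC e * fps_geom x * fpsC x * fpsT.
Proof. by have := fpsC_geomE 1 e x; rewrite !mul1r. Qed.

Lemma fps_mulDT (B : nzRingType) (F q s : fps B) :
  F * (s + q * s * fpsT) = (F + F * q * fpsT) * s.
Proof. by rewrite mulrDr mulrDl -[in RHS]mulrA -fpsT_comm !mulrA. Qed.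

Lemma sigma_letterE F z : F * sigma_letter (E z) =
  F * fpsC (gen (E z)) + F * sigma_letter (E z) * fpsC (gen X) * fpsT.
Proof. exact: fpsC_geomE. Qed.

Lemma Phit_sigmaE F z m (h := Phit (F * sigma_letter (E z)) m) :
  h = fpsC m%:R^-1 * (\sum_(a < m) fpsC (bval z) ^+ (m - a) * Phit F a)
      + fpsC m%:R^-1 * h * fpsT.
Proof.
apply: etrans (congr1 (Phit^~ m) (sigma_letterE F z)) _.
apply: etrans (PhitD _ _ _) _; congr (_ + _); first exact: PhitME.
by apply: etrans (PhitMT _ _) _; congr (_ * _); exact: PhitMX.
Qed.

Lemma Phit_E0 F z : Phit (F * sigma_letter (E z)) 0 = 0.
Proof. by rewrite Phit_sigmaE invr0 rmorph0 !mul0r addr0. Qed.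

(** The geometric series in sigma gives h = (S + t h)/m, that is (m-t) h = S. *)
Lemma nsubt_Phit F z m : nsubt _ m * Phit (F * sigma_letter (E z)) m =
  \sum_(a < m) fpsC (bval z) ^+ (m - a) * Phit F a.
Proof.
case: m => [|m]; first by rewrite big_ord0 Phit_E0 mulr0.
have := congr1 (fun x => m.+1%:R * x) (Phit_sigmaE F z m.+1).
set h := Phit _ _; set S := \sum_(a < _) _ => /=.
rewrite mulrDr !mulrA fpsC_natV !mul1r /nsubt mulrBl => ->.
by rewrite [fpsT * _]mulrC addrK.
Qed.

Lemma Phit_E F z m : nsubt _ m.+1 * Phit (F * sigma_letter (E z)) m.+1 =
  fpsC (bval z) * (nsubt _ m * Phit (F * sigma_letter (E z)) m + Phit F m).
Proof.
rewrite !nsubt_Phit big_ord_recr /= subSnn expr1 mulrDr mulr_sumr; congr (_ + _).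
by apply: eq_bigr => a _; rewrite subSn 1?ltnW // exprS mulrA.
Qed.

Lemma Phit_decays K F : decays K (Phit F).
Proof.
rewrite /decays /fnorm.
elim: K => [|K [C [p [C0 H]]]].
  by exists 0, 0%N; split => // m; rewrite big_ord0 !mul0r.
have [D [q [D0 HD]]] := Phi_bound (F K).
have l1 m := harm1_ge1 R m.
exists (C + D), (p + q)%N; split; first exact: addr_ge0.
move=> m; rewrite big_ord_recr /= !mulrDl; apply: lerD.
  apply: le_trans (H m) _; rewrite ler_wpM2r ?invr_ge0 // ler_wpM2l //.
  by rewrite ler_weXn2l ?leq_addr.
apply: le_trans (HD m) _; rewrite ler_wpM2r ?invr_ge0 // ler_wpM2l //.
by rewrite ler_weXn2l ?leq_addl.
Qed.

Lemma sigma_tau_X : sigma (tau_letter X) = sigma_letter (E BB1) :> fps A.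
Proof. exact: sigma_gen. Qed.

Lemma sigma_tau_1 : sigma (tau_letter (E BB1)) = fpsC (gen X) :> fps A.
Proof. by rewrite /= eqxx sigma_gen. Qed.

HB.instance Definition _ := GRing.isZmodMorphism.Build (fps A) (fps A) (@sigma R)
  (@sigma_is_zmod_morphism R).
HB.instance Definition _ := GRing.isMonoidMorphism.Build (fps A) (fps A) (@sigma R)
  (@sigma_is_monoid_morphism R).

(** The summand G t contributes t G(n), which cancels the -t of (n-t) G(n) in [Phit_E]; hence a bare
    n on the right. *)
Lemma Phit_fix F G w : G = (F + G * fpsT) * sigma_letter (E w) ->
  Phit G 0 = 0 /\ forall n, nsubt _ n.+1 * Phit G n.+1 =
    fpsC (bval w) * (n%:R * Phit G n + Phit F n).
Proof.
move=> GE; have H m := congr1 (Phit^~ m) GE.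
split=> [|n]; first by apply: etrans (H _) _; exact: Phit_E0.
apply: etrans (congr1 ( *%R _) (H _)) _; apply: etrans (Phit_E _ _ _) _.
have D : Phit (F + G * fpsT) n = Phit F n + Phit G n * fpsT.
  by apply: etrans (PhitD _ _ _) _; congr (_ + _); exact: PhitMT.
have E := esym (H n); rewrite /= in E; rewrite E D.
by congr (_ * _); rewrite /nsubt; ring.
Qed.

(** Multiplying the recurrence of [Phit_fix] by z-1 clears the denominator of w = z/(z-1), and the
    sign in tau gives the form required by [cpair_e]. For z = 1 the dual letter is x, and F(n) = n
    h(n) at n = 0 forces F(0) = 0. *)
Lemma Phit_dual F z (h := Phit (F * sigma (tau_letter (E z)))) :
    (z = BB1 -> Phit F 0 = 0) -> h 0%N = 0 /\ forall n,
  fpsC (bval z) * Phit F n = fpsC (bval z) * (n%:R * h n)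
    - fpsC (bval z - 1) * (nsubt _ n.+1 * h n.+1).
Proof.
rewrite {}/h; have [-> F0|z1 _] := eqVneq z BB1.
  rewrite sigma_tau_1 Phit_X0; split => // n.
  by rewrite Phit_X ?F0 //= subrr rmorph0 mul0r subr0.
have w1 : bval z - 1 != 0 by rewrite subr_eq0; move: z1; rewrite -val_eqE.
have wE : fpsC (bval z - 1) * fpsC (bval (bdual z)) = fpsC (bval z).
  by rewrite -rmorphM /= bdualE // mulrC divfK.
set w := bdual z in wE *; pose q : fps A := fpsC (gen (E w)) * fps_geom (gen (E w)).
have -> : tau_letter (E z) = - q by rewrite /tau_letter (negPf z1).
rewrite rmorphN mulrN; set G := F * sigma q.
have GE : G = (F + G * fpsT) * sigma_letter (E w).
  rewrite -fps_mulDT {1}/G; congr (_ * _).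
  apply: etrans (congr1 (@sigma R) (fpsC_geom1E (gen (E w)) (gen (E w)))) _.
  apply: etrans (rmorphD _ _ _) _; congr (_ + _); first exact: sigma_gen.
  apply: etrans (rmorphM _ _ _) _; congr (_ * _); last exact: sigma_t.
  by apply: etrans (rmorphM _ _ _) _; congr (_ * _); exact: sigma_gen.
have [G0 /(_ _)GS] := Phit_fix GE.
split=> [|n]; first by rewrite PhitN G0 oppr0.
rewrite !PhitN !mulrN GS opprK; move: (Phit G n) (Phit F n) => a b.
by rewrite [fpsC (bval z - 1) * _]mulrA wE; ring.
Qed.

End ChainSums.

Section DecayClosure.
Variables (R : realType) (K : nat).
Implicit Types f g : nat -> fps R[i].

Lemma decays_ext f g : f =1 g -> decays K f -> decays K g.
Proof. by move=> /funext->. Qed.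

Lemma decays0 : decays K (fun=> (0 : fps R[i])).
Proof. by exists 0, 0%N; split => // m; rewrite fnorm0 !mul0r. Qed.

Lemma decays_sum (I : Type) (r : seq I) (f : I -> nat -> fps R[i]) :
  (forall i, decays K (f i)) -> decays K (fun n => \sum_(i <- r) f i n).
Proof.
move=> H; elim: r => [|i r IHr].
  by apply: decays_ext decays0 => n; rewrite big_nil.
by apply: decays_ext (decaysD (H i) IHr) => n; rewrite big_cons.
Qed.

(** Multiplication by t shifts the coefficients up, so it gains one order of precision in t. *)
Lemma decaysMT f : decays K f -> decays K.+1 (fun n => f n * fpsT).
Proof.
move=> [C [p [C0 H]]]; exists C, p; split=> // m.
apply: le_trans (H m); rewrite /fnorm big_ord_recl coeftMT nc0 add0r.
by apply: ler_sum => k _; rewrite coeftMT.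
Qed.

End DecayClosure.

(** * Transport of whole words, and duality up to a vanishing error *)

Section Transport.
Variable R : realType.
Local Notation A := (alg R).
Implicit Types (l : letter R) (F G : fps A) (N K : nat) (u s w : seq (letter R)).

Local Notation cpairt N F G := (cpair N (Phit F) (Phit G)).

Lemma transport_letter K F G l :
    (l = X -> Phit F 0 = 0) -> (l = E BB1 -> Phit G 0 = 0) ->
  decays K (fun N => cpairt N (F * sigma_letter l) G
                     - cpairt N F (G * sigma (tau_letter l))).
Proof.
case: l => [/(_ erefl) F0 _|z _ G0].
  rewrite sigma_tau_X.
  have h0 := Phit_E0 G (@BB1 R).
  have hS n : nsubt _ n.+1 * Phit (G * sigma_letter (E BB1)) n.+1 =
      nsubt _ n * Phit (G * sigma_letter (E BB1)) n + Phit G n.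
    by rewrite Phit_E /= rmorph1 mul1r.
  apply: decays_ext (decays_csum (Phit_X0 F) (Phit_decays K _)
    (Phit_decays K (G * sigma_letter (E BB1)))) => N.
  by apply/esym/cpair_x => // n; exact: Phit_X.
have [h0 hS] := @Phit_dual R G z (fun e => G0 (congr1 (@E R) e)).
have z0 : bval z != 0.
  by case/orP: (bvalP z) => [/and3P[] //|/eqP->]; exact: oner_neq0.
(* [cpair_e] gives the difference multiplied by z, which is nonzero on the alphabet and can be
   divided out. *)
have divz (D S : fps R[i]) : fpsC (bval z) * D = - S -> fpsC (- (bval z)^-1) * S = D.
  move=> /(congr1 (fun x => fpsC (- (bval z)^-1) * - x)); rewrite opprK => <-.
  by rewrite mulrN rmorphN mulNr opprK mulrA -rmorphM mulVf // rmorph1 mul1r.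
apply: decays_ext (decaysC (- (bval z)^-1)
  (decaysD (decaysC (bval z - 1)
     (decays_csum (Phit_E0 F z) (Phit_decays K _)
        (Phit_decays K (G * sigma (tau_letter (E z))))))
     (decays_connector (Phit_decays K (F * sigma_letter (E z)))
        (Phit_decays K (G * sigma (tau_letter (E z))))))) => N.
exact/divz/(cpair_e N (Phit_E0 F z) (Phit_E F z) h0 hS).
Qed.

Definition sigma_word w : fps A := \prod_(l <- w) sigma_letter l.
Definition dual_word w : fps A := \prod_(l <- rev w) sigma (tau_letter l).

Lemma Phit_sigma_word0 w : w != [::] -> Phit (sigma_word w) 0 = 0.
Proof.
case/lastP: w => // w l _; rewrite /sigma_word big_rcons.
case: l => [|z]; [exact: Phit_X0 | exact: Phit_E0].
Qed.

Lemma Phit_dual_word0 w : w != [::] -> Phit (dual_word w) 0 = 0.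
Proof.
elim: w => // l w IHw _; rewrite /dual_word rev_cons big_rcons -/(dual_word w).
case: l => [|z]; first by rewrite sigma_tau_X Phit_E0.
have [->|/eqP z1] := eqVneq z BB1; first by rewrite sigma_tau_1 Phit_X0.
by have [] := @Phit_dual R (dual_word w) z (fun e => False_ind _ (z1 e)).
Qed.

(** An x being moved is not the first letter, so what is left of u is nonempty; an e_1 being moved
    is not the last letter, as |1| = 1, so s is nonempty. This gives the vanishing at 0 that
    [transport_letter] requires. *)
Lemma transport_word K u s : head_ok (u ++ s) -> last_ok (u ++ s) ->
  decays K (fun N => cpairt N (sigma_word u) (dual_word s)
                     - cpairt N 1 (dual_word (u ++ s))).
Proof.
elim/last_ind: u s => [|u l IHu] s.
  move=> _ _; apply: decays_ext (decays0 _ _) => N.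
  by rewrite /sigma_word big_nil subrr.
rewrite cat_rcons => Hh Hl.
have F0 : l = X -> Phit (sigma_word u) 0 = 0.
  move=> lX; apply: Phit_sigma_word0; apply/eqP => u0.
  by move: Hh; rewrite u0 lX.
have G0 : l = E BB1 -> Phit (dual_word s) 0 = 0.
  move=> lE; apply: Phit_dual_word0; apply/eqP => s0.
  move: Hl; rewrite s0 lE cats1 /last_ok.
  by case: (u) => [|k v] /=; rewrite ?last_rcons ?normr1 eqxx.
apply: decays_ext (decaysD (transport_letter K F0 G0) (IHu (l :: s) Hh Hl)) => N.
rewrite /sigma_word big_rcons /= /dual_word [rev (l :: s)]rev_cons big_rcons /=.
by rewrite addrA subrK.
Qed.

Lemma Phit1 n : Phit (1 : fps A) n = (n == 0%N)%:R.
Proof.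
apply/fpsP => k; rewrite PhitE -(rmorph_nat (@fpsC _)) /=.
case: k => [|k] /=; last by rewrite Phi0.
by rewrite -mpolyC1E PhiU fm1 rmorph1 mul1r.
Qed.

Lemma cpairt1r N F : cpairt N F 1 = \sum_(m < N.+1) Phit F m.
Proof.
rewrite /cpair big_ord_recl big1 => [|i _]; last by rewrite Phit1 mulr0.
rewrite Phit1 mulr1 addr0; apply: eq_bigr => m _.
by rewrite connectorm0 mulr1.
Qed.

Lemma cpairt1l N F : cpairt N 1 F = \sum_(m < N.+1) Phit F m.
Proof. by rewrite cpairC cpairt1r. Qed.

Definition psum N F : fps R[i] := \sum_(m < N.+1) Phit F m.

Lemma psumD N F G : psum N (F + G) = psum N F + psum N G.
Proof. by rewrite -big_split; apply: eq_bigr => m _; exact: PhitD. Qed.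

Lemma psumMT N F : psum N (F * fpsT) = psum N F * fpsT.
Proof. by rewrite /psum mulr_suml; apply: eq_bigr => m _; exact: PhitMT. Qed.

Lemma duality_word K (w : word R) : admissible w ->
  decays K (fun N => psum N (sigma_word w) - psum N (dual_word w)).
Proof.
case/orP => [/eqP->|/andP[Hh Hl]].
  apply: decays_ext (decays0 _ _) => N.
  by rewrite /sigma_word /dual_word !big_nil subrr.
have := @transport_word K w [::]; rewrite cats0 => /(_ Hh Hl).
apply: decays_ext => N; rewrite cpairt1l.
by rewrite [dual_word [::]]big_nil cpairt1r.
Qed.

Lemma PhitMscalC c F m : Phit (scalC R c * F) m = fpsC (ratr c) * Phit F m.
Proof.
apply/fpsP => k; rewrite [RHS]coeftCM !PhitE [(_ * F) k]coeftCM.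
rewrite [mkmalgU _ _ * _]fgmulUg Phi_sum.
rewrite [Phi (F k) m](mmapE ratr (fun w : word R => phi w m)) mulr_sumr.
by apply: eq_bigr => w _; rewrite PhiU rmorphM -mulrA mul1m.
Qed.

Lemma sigma_fpsC (a : A) :
  sigma (fpsC a) = \sum_(w <- msupp a) scalC R (mcoeff w a) * sigma_word w.
Proof. by rewrite /sigma fps_extendC //; exact: raddfB. Qed.

Lemma tau_fpsC (a : A) : tau (fpsC a) =
  \sum_(w <- msupp a) scalC R (mcoeff w a) * \prod_(l <- rev w) tau_letter l.
Proof. by rewrite /tau fps_extendC //; exact: raddfB. Qed.

Lemma sigma_scalC c : sigma (scalC R c) = scalC R c.
Proof.
have -> : sigma (scalC R c) = scalC R c * sigma_word (mone : word R).
  transitivity (mmap (@scalC R) (fun w : word R => sigma_word w) (mkmalgU mone c)).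
    by apply: fps_extendC; exact: raddfB.
  exact: mmapU.
by rewrite fm1 /sigma_word big_nil mulr1.
Qed.

Lemma sigma_tau_fpsC (a : A) : sigma (tau (fpsC a)) =
  \sum_(w <- msupp a) scalC R (mcoeff w a) * dual_word w.
Proof.
rewrite tau_fpsC rmorph_sum; apply: eq_bigr => w _.
apply: etrans (rmorphM _ _ _) _; congr (_ * _); first exact: sigma_scalC.
exact: rmorph_prod.
Qed.

Lemma psum_scal N (a : A) (h : word R -> fps A) :
  psum N (\sum_(w <- msupp a) scalC R (mcoeff w a) * h w) =
  \sum_(w <- msupp a) fpsC (ratr (mcoeff w a)) * psum N (h w).
Proof.
elim: (enum_fset (msupp a)) => [|w r IHr].
  rewrite !big_nil /psum big1 // => m _; apply/fpsP => k; exact: Phi0.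
rewrite !big_cons psumD IHr; congr (_ + _).
by rewrite /psum mulr_sumr; apply: eq_bigr => m _; exact: PhitMscalC.
Qed.

Lemma duality_fpsC K (a : A) : inA0 a ->
  decays K (fun N => psum N (sigma (fpsC a)) - psum N (sigma (tau (fpsC a)))).
Proof.
move=> a0; pose d w N := psum N (sigma_word w) - psum N (dual_word w).
(* [decays_sum] wants decay at every index, so the terms outside the support, where admissibility is
   unknown, are set to 0. *)
have H (w : word R) : decays K (fun N => if w \in msupp a then
    fpsC (ratr (mcoeff w a)) * d w N else 0).
  have [wa|_] := boolP (w \in msupp a); last exact: decays0.
  exact/decaysC/duality_word/a0.
apply: decays_ext (decays_sum (enum_fset (msupp a)) H) => N.
have E1 := etrans (congr1 (psum N) (sigma_fpsC a)) (psum_scal _ _ _).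
have E2 := etrans (congr1 (psum N) (sigma_tau_fpsC a)) (psum_scal _ _ _).
apply: etrans _ (esym (congr2 (fun x y => x - y) E1 E2)).
rewrite -sumrB [LHS]big_seq [RHS]big_seq; apply: eq_bigr => w wa.
by rewrite wa /d mulrBr.
Qed.

Lemma fps_split (B : nzRingType) (f : fps B) :
  f = fpsC (f 0%N) + Fps (fun k => f k.+1) * fpsT.
Proof. by apply/fpsP => -[|k]; rewrite coeftD coeftMT /= ?addr0 ?add0r. Qed.

Lemma tauD F G : tau (F + G) = tau F + tau G.
Proof.
have B := @tau_is_zmod_morphism R.
have t0 : tau 0 = 0 :> fps A by have := B 0 0; rewrite !subrr.
by rewrite -[G in LHS]opprK B -[- G]sub0r B t0 sub0r opprK.
Qed.

Lemma sigma_tauS F : sigma (tau F) = sigma (tau (fpsC (F 0%N)))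
  + sigma (tau (Fps (fun k => F k.+1))) * fpsT.
Proof.
rewrite {1}[F]fps_split tauD; apply: etrans (rmorphD _ _ _) _; congr (_ + _).
rewrite tau_antiM tau_t; apply: etrans (rmorphM _ _ _) _.
by apply: etrans _ (esym (fpsT_comm _)); congr (_ * _); exact: sigma_t.
Qed.

Lemma sigmaS F : sigma F = sigma (fpsC (F 0%N))
  + sigma (Fps (fun k => F k.+1)) * fpsT.
Proof.
rewrite {1}[F]fps_split; apply: etrans (rmorphD _ _ _) _; congr (_ + _).
by apply: etrans (rmorphM _ _ _) _; congr (_ * _); exact: sigma_t.
Qed.

(** Induction on the precision K: sigma and tau fix t, so all but the constant coefficient is a
    multiple of t, and [decaysMT] gains the missing order. *)
Lemma duality_psum K F : inA0t F ->
  decays K (fun N => psum N (sigma F) - psum N (sigma (tau F))).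
Proof.
elim: K F => [|K IHK] F F0.
  by exists 0, 0%N; split => // m; rewrite /fnorm big_ord0 !mul0r.
have H0 := @duality_fpsC K.+1 (F 0%N) (F0 0%N).
have H1 := decaysMT (IHK (Fps (fun k => F k.+1)) (fun k => F0 k.+1)).
apply: decays_ext (decaysD H0 H1) => N.
have psumS G H : psum N (G + H * fpsT) = psum N G + psum N H * fpsT.
  by apply: etrans (psumD _ _ _) _; congr (_ + _); exact: psumMT.
have E1 := etrans (congr1 (psum N) (sigmaS F)) (psumS _ _).
have E2 := etrans (congr1 (psum N) (sigma_tauS F)) (psumS _ _).
apply: etrans _ (esym (congr2 (fun x y => x - y) E1 E2)).
have aux (a b c d t : fps R[i]) : a - b + (c - d) * t = (a + c * t) - (b + d * t).
  by ring.
exact: aux.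
Qed.

End Transport.

(** * Truncated polylogarithms as chain sums, and absolute summability *)

Section TruncatedSums.
Variable R : realType.
Implicit Types (l : letter R) (w : seq (letter R)) (s : seq (BB R * nat)).
Implicit Types (a m n N : nat).

(** Sums over the chains that continue from a, reading the word from the left, whereas [phi] grows
    chains at their end; [sum_foldl_act] is the adjunction between the two. *)
Fixpoint chain N w a : R[i] :=
  match w with
  | [::] => 1
  | X :: w' => a%:R^-1 * chain N w' a
  | E z :: w' =>
      \sum_(m < N.+1 | (a < m)%N) bval z ^+ (m - a) * m%:R^-1 * chain N w' m
  end.

Lemma sum_foldl_act N w (f : nat -> R[i]) :
  \sum_(m < N.+1) foldl (fun f l => act l f) f w m =
  \sum_(a < N.+1) f a * chain N w a.
Proof.
elim: w f => [|[|z] w IHw] f /=.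
- by apply: eq_bigr => m _; rewrite mulr1.
- by rewrite IHw; apply: eq_bigr => a _ /=; rewrite mulrCA mulrA.
rewrite IHw /=.
under [RHS]eq_bigr do rewrite mulr_sumr big_mkcond.
rewrite exchange_big; apply: eq_bigr => m _; rewrite -big_mkcond /=.
rewrite (big_ord_widen N.+1 (fun a => bval z ^+ (m - a) * f a)) 1?ltnW //.
by rewrite mulr_sumr mulr_suml; apply: eq_bigr => a _; ring.
Qed.

Fixpoint index_chain N s a : R[i] :=
  if s is (z, k) :: s' then
    \sum_(m < N.+1 | (a < m)%N) bval z ^+ (m - a) / m%:R ^+ k * index_chain N s' m
  else 1.

Lemma chain_index N w a : chain N w a =
  a%:R^-1 ^+ (word_index_rec w).1 * index_chain N (word_index_rec w).2 a.
Proof.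
elim: w a => [|[|z] w IHw] a /=; first by rewrite expr0 mul1r.
  by rewrite IHw exprS mulrA.
rewrite expr0 mul1r; apply: eq_bigr => m _.
by rewrite IHw exprS invfM exprVn !mulrA.
Qed.

Lemma index_chainE N s a : index_chain N s a =
  \sum_(m : (size [seq p.2 | p <- s]).-tuple 'I_N.+1 | sorted ltn (a :: map val m))
    let m_ := nth 0%N (a :: map val m) in
    \prod_(j < size [seq p.2 | p <- s])
      ([seq bval p.1 | p <- s]`_j ^+ (m_ j.+1 - m_ j)
       / (m_ j.+1)%:R ^+ nth 0%N [seq p.2 | p <- s] j).
Proof.
elim: s a => [|[z k] s IHs] a.
  by rewrite (big_pred1 [tuple]) /= ?big_ord0 // => m; rewrite tuple0 /= eqxx.
rewrite [LHS]/=; set n := size [seq p.2 | p <- s] in IHs.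
rewrite [size _]/= -/n.
rewrite (reindex (fun p : 'I_N.+1 * n.-tuple 'I_N.+1 => cons_tuple p.1 p.2)) /=; last first.
  exists (fun t : n.+1.-tuple 'I_N.+1 => (thead t, behead_tuple t)).
    by move=> [x t] _ /=; congr (_, _); apply: val_inj.
  by move=> t _; apply: val_inj; rewrite /= [in RHS](tuple_eta t).
under [RHS]eq_bigl do rewrite -[path _ _ _]/(sorted ltn (_ :: map val _)).
rewrite -(pair_big_dep (fun x : 'I_N.+1 => (a < x)%N)
  (fun (x : 'I_N.+1) (t : n.-tuple 'I_N.+1) => sorted ltn (nat_of_ord x :: map val t))
  (fun x t => \prod_(j < n.+1) ([seq bval p.1 | p <- (z, k) :: s]`_j ^+
     (nth 0%N (a :: nat_of_ord x :: map val t) j.+1 -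
      nth 0%N (a :: nat_of_ord x :: map val t) j) /
     (nth 0%N (a :: nat_of_ord x :: map val t) j.+1)%:R ^+
     nth 0%N [seq p.2 | p <- (z, k) :: s] j))) /=.
apply: eq_bigr => x _; rewrite IHs mulr_sumr; apply: eq_bigr => t _.
by rewrite big_ord_recl.
Qed.

(** Chains start at a = 0, where an initial x would contribute 0^-1 = 0 while [word_index] ignores
    it; the head condition excludes this case. *)
Lemma Lish_trunc_phi N w : head_ok w || (w == [::]) ->
  Lish_trunc [seq bval p.1 | p <- word_index w] [seq p.2 | p <- word_index w] N
  = \sum_(m < N.+1) phi w m.
Proof.
move=> Hw; rewrite sum_foldl_act big_ord_recl /= mul1r big1 ?addr0; last first.
  by move=> i _; rewrite mul0r.
rewrite chain_index.
have -> : (word_index_rec w).1 = 0%N by case: w Hw => [|[|z] w].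
by rewrite expr0 mul1r index_chainE.
Qed.

Lemma sum_harm1_bound p : exists B : R, forall N,
  \sum_(n < N) harm1 R n ^+ p / n.+1%:R / n.+1%:R <= B.
Proof.
have [B HB] := harm1_bound R p; exists (2 * B) => N.
apply: (@le_trans _ _ (2 * \sum_(n < N) harm1 R n ^+ p / (n.+1%:R * n.+2%:R))).
  rewrite mulr_sumr; apply: ler_sum => n _.
  have -> : 2 * (harm1 R n ^+ p / (n.+1%:R * n.+2%:R)) =
      harm1 R n ^+ p / n.+1%:R * (2 / n.+2%:R) by rewrite invfM; ring.
  by rewrite ler_wpM2l ?invn_le // mulr_ge0 ?invr_ge0 // exprn_ge0 ?harm1_ge0.
rewrite ler_wpM2l //; apply: le_trans (HB N); rewrite lerDl.
by rewrite mulr_ge0 ?invr_ge0 // exprn_ge0 ?harm1_ge0.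
Qed.

(** The convolution satisfies c(m+1) = r (c(m) + g(m)); summing this gives [key]. *)
Lemma geom_conv_bound (r B : R) (g : nat -> R) : 0 <= r -> r < 1 ->
    (forall n, 0 <= g n) -> (forall N, \sum_(n < N) g n <= B) ->
  forall N, \sum_(m < N) \sum_(a < m) r ^+ (m - a) * g a <= B / (1 - r).
Proof.
move=> r0 r1 g0 HB N; pose c m := \sum_(a < m) r ^+ (m - a) * g a.
have c0 m : 0 <= c m by apply: sumr_ge0 => a _; rewrite mulr_ge0 ?exprn_ge0.
have cS m : c m.+1 = r * (c m + g m).
  rewrite /c big_ord_recr /= subSnn expr1 mulrDr mulr_sumr; congr (_ + _).
  by apply: eq_bigr => a _; rewrite subSn 1?ltnW // exprS mulrA.
have key : (1 - r) * \sum_(m < N) c m + c N = r * \sum_(n < N) g n.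
  elim: N => [|N IHN]; first by rewrite /c !big_ord0 !mulr0 addr0.
  by rewrite !big_ord_recr /= mulrDr [RHS]mulrDr -IHN cS; ring.
rewrite ler_pdivlMr ?subr_gt0 // mulrC.
apply: (@le_trans _ _ (r * \sum_(n < N) g n)); first by rewrite -key lerDl.
apply: le_trans (HB N); rewrite ler_piMl ?(ltW r1) //.
by apply: sumr_ge0.
Qed.

(** The last letter decides. An x contributes a second factor 1/m. For e_z with |z| < 1, the bound
    1/m <= 1/(a+1) moves that factor inside the sum, which becomes a convolution with a geometric
    series. *)
Lemma phi_summable w : last_ok w ->
  exists B : R, forall N, \sum_(m < N) nc (phi w m) <= B.
Proof.
case/lastP: w => // w l Hl; have {Hl} : last_ok [:: l].
  by move: Hl; rewrite /last_ok; case: w => [|k v] //=; rewrite last_rcons.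
have [C [p [C0 Hw]]] := phi_bound w; rewrite phi_rcons.
have [B HB] := sum_harm1_bound p.
have g0 n : 0 <= harm1 R n ^+ p / n.+1%:R / n.+1%:R.
  by rewrite !mulr_ge0 ?invr_ge0 // exprn_ge0 ?harm1_ge0.
case: l => [_|z z1] /=.
  exists (2 * C * B) => N; apply: le_trans (ler_wpM2l _ (HB N)); rewrite ?mulr_ge0 //.
  rewrite mulr_sumr; apply: ler_sum => m _; rewrite ncM ncV nc_nat.
  apply: le_trans (ler_pM _ _ (invn_le R m) (Hw m)) _; rewrite ?invr_ge0 ?nc_ge0 //.
  by rewrite le_eqVlt; apply/orP; left; apply/eqP; ring.
have r1 : nc (bval z) < 1.
  rewrite lt_neqAle inB_le1 andbT; apply: contra z1 => /eqP z1.
  by rewrite -ncE z1.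
exists (C * (B / (1 - nc (bval z)))) => N.
apply: le_trans (ler_wpM2l C0 (geom_conv_bound (nc_ge0 _) r1 g0 HB N)).
rewrite mulr_sumr; apply: ler_sum => m _; rewrite ncM ncV nc_nat.
apply: le_trans (ler_wpM2l _ (nc_sum _ _ _)) _; rewrite ?invr_ge0 //.
rewrite !mulr_sumr; apply: ler_sum => a _; rewrite ncM ncX.
have -> : C * (nc (bval z) ^+ (m - a) * (harm1 R a ^+ p / a.+1%:R / a.+1%:R)) =
  a.+1%:R^-1 * (nc (bval z) ^+ (m - a) * (C * harm1 R a ^+ p / a.+1%:R)) by ring.
apply: ler_pM; rewrite ?invr_ge0 ?mulr_ge0 ?nc_ge0 ?exprn_ge0 ?nc_ge0 //.
  have m0 : (0 < m)%N by exact: leq_ltn_trans (ltn_ord a).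
  by rewrite lef_pV2 ?posrE ?ltr0n // ler_nat.
by rewrite ler_wpM2l ?exprn_ge0 ?nc_ge0.
Qed.

End TruncatedSums.

(** * Passage to the limit *)

Section Limits.
Variable R : realType.
Implicit Types (w : seq (letter R)) (F : fps (alg R)).
Local Open Scope classical_set_scope.

Lemma abs_bounded_cvg (x : nat -> R) B : (forall N, \sum_(m < N) `|x m| <= B) ->
  cvgn (fun N => \sum_(m < N) x m).
Proof.
move=> HB; rewrite (_ : (fun N => _) = series x); last first.
  by apply/funext => N; rewrite /series /= big_mkord.
apply: normed_cvg.
rewrite (_ : [normed series x] = (fun N => \sum_(m < N) `|x m|)); last first.
  by apply/funext => N; rewrite /normed_series_of /series /= big_mkord.
apply: nondecreasing_is_cvgn.
  by apply/nondecreasing_seqP => N; rewrite big_ord_recr /= lerDl.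
by exists B => _ [N _ <-]; exact: HB.
Qed.

Lemma nc_ReIm (x : R[i]) : `|complex.Re x| <= nc x /\ `|complex.Im x| <= nc x.
Proof.
case: x => a b; rewrite /nc normc_def /=.
by split; rewrite -sqrtr_sqr ler_wsqrtr // ?lerDl ?lerDr sqr_ge0.
Qed.

Lemma complex_cvg (x : nat -> R[i]) (a b : R) :
    (fun n => complex.Re (x n)) @ \oo --> a ->
    (fun n => complex.Im (x n)) @ \oo --> b ->
  (x : nat -> R[i]^o) @ \oo --> (a +i* b : R[i]^o).
Proof.
move=> /cvgrPdist_lt Ha /cvgrPdist_lt Hb; apply/cvgrPdist_lt => e e0.
have [e1 e2] : 0 < complex.Re e /\ e = (complex.Re e)%:C.
  by case: e e0 => u v; rewrite ltcE /= => /andP[/eqP-> ->].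
have h0 : 0 < complex.Re e / 2 by rewrite divr_gt0.
near=> n.
have An : `|a - complex.Re (x n)| < complex.Re e / 2 by near: n; exact: Ha.
have Bn : `|b - complex.Im (x n)| < complex.Re e / 2 by near: n; exact: Hb.
rewrite e2 -ncE ltcR; apply: le_lt_trans (_ : _ <=
  `|a - complex.Re (x n)| + `|b - complex.Im (x n)|) _; last by lra.
case: (x n) => c d /=; rewrite /nc normc_def /=.
move: (a - c) (b - d) => u v; rewrite -[leRHS]ger0_norm ?addr_ge0 //.
rewrite -sqrtr_sqr ler_wsqrtr // sqrrD !real_normK ?num_real //.
by rewrite -addrA [_ *+ 2 + _]addrC addrA lerDl mulrn_wge0 // mulr_ge0.
Unshelve. all: by end_near. Qed.

Lemma phi_cvg w : last_ok w ->
  cvgn ((fun N => \sum_(m < N.+1) phi w m) : nat -> R[i]^o).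
Proof.
move=> /phi_summable[B HB].
have ReB N : \sum_(m < N) `|complex.Re (phi w m)| <= B.
  by apply: le_trans (HB N); apply: ler_sum => m _; have [] := nc_ReIm (phi w m).
have ImB N : \sum_(m < N) `|complex.Im (phi w m)| <= B.
  by apply: le_trans (HB N); apply: ler_sum => m _; have [] := nc_ReIm (phi w m).
have /cvg_ex[a Ha] := @abs_bounded_cvg (fun m => complex.Re (phi w m)) B ReB.
have /cvg_ex[b Hb] := @abs_bounded_cvg (fun m => complex.Im (phi w m)) B ImB.
apply/cvg_ex; exists (a +i* b); apply: complex_cvg.
  rewrite -(cvg_shiftS (fun N => \sum_(m < N) complex.Re (phi w m))) /= in Ha.
  by under eq_fun do rewrite raddf_sum.
rewrite -(cvg_shiftS (fun N => \sum_(m < N) complex.Im (phi w m))) /= in Hb.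
by under eq_fun do rewrite raddf_sum.
Qed.

(** [Lish] is a [limn], which has its meaning only once [phi_cvg] provides convergence. *)
Lemma L_word_cvg w : admissible w ->
  ((fun N => \sum_(m < N.+1) phi w m) : nat -> R[i]^o) @ \oo --> (L_word w : R[i]^o).
Proof.
move=> Hw; rewrite /L_word /Lish.
have -> : Lish_trunc [seq bval p.1 | p <- word_index w] [seq p.2 | p <- word_index w]
    = (fun N => \sum_(m < N.+1) phi w m).
  apply/funext => N; apply: Lish_trunc_phi.
  by case/orP: Hw => [->|/andP[-> _] //]; rewrite orbT.
case/orP: Hw => [/eqP->|/andP[_ /phi_cvg //]].
apply: (cvgP (1 : R[i]^o)); apply: cvg_near_cst; apply: nearW => N.
by rewrite big_ord_recl big1 ?addr0.
Qed.

Lemma psum_cvg F k : inA0t F ->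
  ((fun N => psum N F k) : nat -> R[i]^o) @ \oo --> (L F k : R[i]^o).
Proof.
move=> F0; rewrite /L /= /mmap.
have -> : (fun N => psum N F k) = (fun N =>
    \sum_(w <- msupp (F k)) ratr (mcoeff w (F k)) * \sum_(m < N.+1) phi w m).
  apply/funext => N; rewrite /psum coeft_sum.
  under [RHS]eq_bigr do rewrite mulr_sumr.
  by rewrite exchange_big.
have : forall w : word R, w \in enum_fset (msupp (F k)) -> admissible w by exact: F0.
elim: (enum_fset _) => [|w r IHr] Hr.
  rewrite big_nil; under eq_fun do rewrite big_nil; exact: cvg_cst.
rewrite big_cons; under eq_fun do rewrite big_cons.
apply: (@cvgD _ R[i]^o); last by apply: IHr => v vr; apply: Hr; rewrite inE vr orbT.
apply: (@cvgM R[i]); first exact: cvg_cst.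
by apply: L_word_cvg; apply: Hr; rewrite mem_head.
Qed.

End Limits.

Theorem theorem6p7 (R : realType) (w : fps (alg R)) :
  inA0t w -> L (sigma w) = L (sigma (tau w)).
Proof.
move=> w0; apply/fpsP => k.
have Hs := @psum_cvg R _ k (sigma_inA0t w0).
have Ht := @psum_cvg R _ k (sigma_inA0t (tau_inA0t w0)).
have Hd := decays_cvg0 (leqnn k.+1) (duality_psum k.+1 w0).
apply/eqP; rewrite -subr_eq0; apply/eqP.
(* The difference of the truncations tends to the difference of the two limits and, by decay modulo
   t^(k+1), also to 0. *)
apply: (@cvg_unique R[i]^o (@norm_hausdorff R[i] R[i]^o) _ _ _ _ (cvgB Hs Ht)).
apply/cvgrPdist_lt => e e0.
have [e1 e2] : 0 < complex.Re e /\ e = (complex.Re e)%:C.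
  by case: e e0 => u v; rewrite ltcE /= => /andP[/eqP-> ->].
move/cvgrPdist_lt: Hd => /(_ _ e1); apply: filterS => N.
by rewrite !sub0r !normrN ger0_norm ?nc_ge0 // e2 -ncE ltcR //.
Qed.
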